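(* Let $m\ge2$, $0<q<1$, $R_z,R_w>0$, and suppose $$a(w_m)=\sum_{s\ge0}w_m^{\langle s\rangle_q}a_s\in\mathscr A_q(R_w;\mathscr X_q),\ \ \mathcal D_q'a_s=0\ \forall s,\qquad b(z_m)=\sum_{r\ge0}z_m^{\langle r\rangle_q}b_r\in\mathscr A_q(R_z;\mathscr X_q),\ \ \mathcal D_q^{\dagger\prime}b_r=0\ \forall r.$$ Define $A_{r,s},B_{r,s}\in\mathscr X_q$ ($r,s\ge0$) by $A_{0,s}=a_s$, $B_{r,0}=b_r$, $A_{r+1,s}=\mathcal D_q'B_{r,s}$, $B_{r,s+1}=-\mathcal D_q^{\dagger\prime}A_{r,s}$. If $0<\rho_z<R_z$ and $0<\rho_w<R_w$ satisfy $\mu_{q,m}\rho_z\rho_w<(1-q)^{-2}$, then the series $$A=\sum_{r,s\ge0}z_m^{\langle r\rangle_q}w_m^{\langle s\rangle_q}A_{r,s},\qquad B=\sum_{r,s\ge0}z_m^{\langle r\rangle_q}w_m^{\langle s\rangle_q}B_{r,s}$$ converge normally in $\mathscr X_q$ for $|z_m|\le\rho_z$, $|w_m|\le\rho_w$. Their sum $f=A+\varepsilon_mB$ is joint Jackson-monogenic, i.e. $\mathcal D_qf=\mathcal D_q^\dagger f=0$, and has the prescribed two-face data $A|_{z_m=0}=a(w_m)$, $B|_{w_m=0}=b(z_m)$. It is the unique joint solution with these data in this normally convergent divided-power class. Moreover, for $|z_m|\le\rho_z$ and $|w_m|\le\rho_w$, $$\|A(z_m,w_m)\|_{\mathscr X_q}\le\Phi_q(\mu_{q,m}\rho_z\rho_w)\bigl(\|a\|_{q,\rho_w}+\rho_z\|\mathcal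 D_q'\|\,\|b\|_{q,\rho_z}\bigr),$$ $$\|B(z_m,w_m)\|_{\mathscr X_q}\le\Phi_q(\mu_{q,m}\rho_z\rho_w)\bigl(\|b\|_{q,\rho_z}+\rho_w\|\mathcal D_q^{\dagger\prime}\|\,\|a\|_{q,\rho_w}\bigr).$$ Thus the extension depends continuously on both boundary data on every smaller bidisc whose radii $\rho_z<R_z$, $\rho_w<R_w$ satisfy $\mu_{q,m}\rho_z\rho_w<(1-q)^{-2}$.
   Context: $[r]_q=\frac{1-q^r}{1-q}$, $[r]_q!=\prod_{k=1}^r[k]_q$, $[\alpha]_q!=\prod_i[\alpha_i]_q!$; $x^{\langle r\rangle_q}=x^r/[r]_q!$. The Jackson derivative is $D_{q,x}f=\frac{f(\dots,qx,\dots)-f(\dots,x,\dots)}{(q-1)x}$ (extended to $x=0$ by continuity), so $D_{q,x}x^{\langle r\rangle_q}=x^{\langle r-1\rangle_q}$. $\varepsilon_i$ is exterior multiplication by the $i$-th basis vector on $\bigwedge\mathbb C^m$, $\iota_i=\varepsilon_i^*$ contraction. Let $z'=(z_1,\dots,z_{m-1})$, $w'=(w_1,\dots,w_{m-1})$. $\mathscr X_q=\mathscr X_q^{(m-1)}$ is the Hilbert completion of $\mathbb C[z',w']\otimes\bigwedge\mathbb C^{m-1}$ (basis $e_S$, $S\subseteq\{1,\dots,m-1\}$) for the norm $\|\sum c_{\alpha,\beta,S}z'^\alpha w'^\beta e_S\|^2=\sum|c_{\alpha,\beta,S}|^2[\alpha]_q!\,[\beta]_q!$. The tangential operators $\mathcal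 D_q'=\sum_{i=1}^{m-1}\varepsilon_iD_{q,z_i}$ and $\mathcal D_q^{\dagger\prime}=\sum_{i=1}^{m-1}\iota_iD_{q,w_i}$ extend to bounded operators on $\mathscr X_q$, and $\mu_{q,m}=\max\{\|\mathcal D_q'\mathcal D_q^{\dagger\prime}\|,\|\mathcal D_q^{\dagger\prime}\mathcal D_q'\|\}$ (operator norms). For a Banach space $X$ and $R>0$, $\mathscr A_q(R;X)$ is the set of $u(x)=\sum_{j\ge0}x^{\langle j\rangle_q}u_j$, $u_j\in X$, with $\|u\|_{q,R}=\sum_{j\ge0}\frac{R^j}{[j]_q!}\|u_j\|_X<\infty$. $\Phi_q(t)=\sum_{k\ge0}\frac{t^k}{([k]_q!)^2}$ for $0\le t<(1-q)^{-2}$. Normal convergence on the bidisc means $\sum_{r,s}\frac{\rho_z^r\rho_w^s}{[r]_q![s]_q!}\|A_{r,s}\|<\infty$ and likewise for $B$. For $f=A+\varepsilon_mB$ with $A,B$ functions of $(z_m,w_m)$ valued in $\mathscr X_q$, the operators are $\mathcal D_q=\mathcal D_q'+\varepsilon_mD_{q,z_m}$, $\mathcal D_q^\dagger=\mathcal D_q^{\dagger\prime}+\iota_mD_{q,w_m}$; explicitly $\mathcal D_qf=0$ means $\mathcal D_q'A=0$ and $D_{q,z_m}A=\mathcal D_q'B$, and $\mathcal D_q^\dagger f=0$ means $\mathcal D_q^{\dagger\prime}B=0$ and $D_{q,w_m}B=-\mathcal D_q^{\dagger\prime}A$. *)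

(* Defs.v *)
From HB Require Import structures.
From mathcomp Require Import all_boot all_order all_algebra complex.
From mathcomp Require mpoly.
From mathcomp Require Import all_classical all_reals all_analysis.
From mathcomp Require Import summability.
(* The notations of multinomials clash with those of analysis. *)
Export -(notations) mpoly.
Export numFieldNormedType.Exports.

Set Implicit Arguments.
Unset Strict Implicit.
Unset Printing Implicit Defensive.

Import Order.TTheory GRing.Theory Num.Theory.

Local Open Scope classical_set_scope.
Local Open Scope ring_scope.
Local Open Scope complex_scope.

Section QNumbers.
Context {R : realType}.
Implicit Types (q : R) (r k : nat).

Definition qnum q r : R := (1 - q ^+ r) / (1 - q).

Definition qfact q r : R := \prod_(1 <= k < r.+1) qnum q k.

(* [z^<r>_q] *)
Definition dpow q (z : R[i]) r : R[i] := z ^+ r / (qfact q r)%:C.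

Definition Phi q (t : R) : \bar R :=
  (\sum_(0 <= k <oo) (t ^+ k / qfact q k ^+ 2)%:E)%E.

(* Norms over [R[i]] take values in [R[i]]. *)
Definition rnorm {V : normedZmodType R[i]} (x : V) : R := complex.Re `|x|.

End QNumbers.

Section JacksonPolynomials.
Context {R : realType} {n : nat}.
Implicit Types (q : R) (i : 'I_n) (p g : mpoly n R[i]).

Definition mvar i : mpoly n R[i] := mpolyX R[i] (mnm1 i).

(* [p(x_1, ..., q x_i, ..., x_n)] *)
Definition mdilate q i p : mpoly n R[i] :=
  comp_mpoly [tuple (if k == i then q%:C *: mvar k else mvar k) | k < n] p.

(* [(p(..., q x_i, ...) - p) / ((q - 1) x_i)]; see [mjacksonP] *)
Definition mjackson q i p : mpoly n R[i] :=
  xget 0 [set g | (q - 1)%:C *: mvar i * g = mdilate q i p - p].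

Lemma mdilateX q i (g : multinom n) :
  mdilate q i (mpolyX _ g) = (q%:C ^+ g i) *: mpolyX R[i] g.
Proof.
rewrite /mdilate comp_mpolyX.
under eq_bigr do rewrite tnth_mktuple.
rewrite [in RHS]mpolyXE_id (bigD1 i)//= eqxx exprZn.
rewrite [in RHS](bigD1 i)//= scalerAl; congr (_ * _).
by apply: eq_bigr => k /negPf ->.
Qed.

Let mvar_scaled_neq0 q i : q != 1 -> (q - 1)%:C *: mvar i != 0.
Proof.
move=> q1; apply/eqP => /(congr1 (mcoeff (mnm1 i))) /eqP.
rewrite mcoeffZ mcoeffX eqxx mulr1 mcoeff0.
by rewrite eq_complex /= eqxx andbT subr_eq0 (negPf q1).
Qed.

Let mjackson_unique q i p g : q != 1 ->
  (q - 1)%:C *: mvar i * g = mdilate q i p - p -> mjackson q i p = g.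
Proof.
move=> q1 hg; rewrite /mjackson; case: xgetP => [h _ /= hh|/(_ g)//].
by apply: (mulfI (mvar_scaled_neq0 i q1)); rewrite hh hg.
Qed.

Let mquotX q i (g : multinom n) : q != 1 ->
  (q - 1)%:C *: mvar i *
    ((qnum q (g i))%:C *: mpolyX R[i] (mnm_sub g (mnm1 i)))
  = mdilate q i (mpolyX _ g) - mpolyX _ g.
Proof.
move=> q1; rewrite mdilateX -{2}[mpolyX _ g]scale1r -scalerBl.
have [gi0|gi0] := eqVneq (g i) 0%N.
  by rewrite gi0 expr0 subrr /qnum expr0 subrr mul0r !scale0r mulr0.
rewrite -scalerAl -scalerAr scalerA /mvar -mpolyXD.
have -> : mnm_add (mnm1 i) (mnm_sub g (mnm1 i)) = g.
  by rewrite addmC submK// lep1mP.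
congr (_ *: _); rewrite -rmorphM /= -rmorphXn /=.
rewrite -(rmorph1 (real_complex R)) -rmorphB; congr (_%:C).
rewrite /qnum -[q - 1]opprB mulNr mulrC divfK ?opprB//.
by rewrite subr_eq0 eq_sym.
Qed.

Lemma mjacksonX q i (g : multinom n) : q != 1 ->
  mjackson q i (mpolyX _ g)
  = (qnum q (g i))%:C *: mpolyX _ (mnm_sub g (mnm1 i)).
Proof. by move=> q1; apply: mjackson_unique => //; exact: mquotX. Qed.

Lemma mjacksonP q i p : q != 1 ->
  (q - 1)%:C *: mvar i * mjackson q i p = mdilate q i p - p.
Proof.
move=> q1.
suff [g hg] : exists g, (q - 1)%:C *: mvar i * g = mdilate q i p - p.
  by rewrite (mjackson_unique q1 hg).
rewrite (mpolyE p) /mdilate; elim/big_ind : _ => [|u v [g hg] [h hh]|g _].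
- by exists 0; rewrite mulr0 comp_mpoly0 subrr.
- by exists (g + h); rewrite mulrDr hg hh comp_mpolyD opprD addrACA.
- exists (mcoeff g p *: ((qnum q (g i))%:C *: mpolyX _ (mnm_sub g (mnm1 i)))).
  by rewrite -scalerAr mquotX// comp_mpolyZ scalerBr.
Qed.

End JacksonPolynomials.

Section Exterior.
Context {n : nat}.

Definition ext_sign (i : 'I_n) (S : {set 'I_n}) : nat :=
  #|[pred k in S | (k < i)%N]|.

(* [u : {ffun {set 'I_n} -> V}] stands for [\sum_S u S * e_S], where
   [e_S = e_(s_1) /\ ... /\ e_(s_k)] for [S = {s_1 < ... < s_k}]. *)
Definition ext_mul {K : pzRingType} {V : lmodType K} (i : 'I_n)
    (u : {ffun {set 'I_n} -> V}) : {ffun {set 'I_n} -> V} :=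
  [ffun S : {set 'I_n} =>
     if i \in S then (-1) ^+ ext_sign i S *: u (S :\ i) else 0].

Definition ext_contr {K : pzRingType} {V : lmodType K} (i : 'I_n)
    (u : {ffun {set 'I_n} -> V}) : {ffun {set 'I_n} -> V} :=
  [ffun S : {set 'I_n} =>
     if i \in S then 0 else (-1) ^+ ext_sign i S *: u (i |: S)].

(* [ext_contr i] is the adjoint of [ext_mul i] for the inner product making
   [e_S] orthonormal. *)
Lemma ext_contr_adj (K : numClosedFieldType) (i : 'I_n)
    (u v : {ffun {set 'I_n} -> K^o}) :
  \sum_S ext_mul i u S * (v S)^* = \sum_S u S * (ext_contr i v S)^*.
Proof.
pose F S := (-1) ^+ ext_sign i S * u (S :\ i) * (v S)^*.
transitivity (\sum_(S : {set 'I_n} | i \in S) F S).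
  rewrite [RHS]big_mkcond; apply: eq_bigr => S _; rewrite /F ffunE.
  by case: ifP => // _; rewrite mul0r.
transitivity (\sum_(S : {set 'I_n} | i \notin S) F (i |: S)).
  rewrite (reindex_onto (fun S => i |: S) (fun S => S :\ i)) /=; last first.
    by move=> S iS; rewrite finset.setD1K.
  apply: eq_bigl => S; rewrite finset.setU11/=.
  apply/eqP/idP => [<-|iS]; first by rewrite !inE eqxx.
  by rewrite finset.setU1K.
rewrite [LHS]big_mkcond; apply: eq_bigr => S _; rewrite /F ffunE.
case: ifPn => [iS|/negPn ->]; last by rewrite conjC0 mulr0.
rewrite (negPf iS) finset.setU1K// rmorphM rmorphXn rmorphN1.
have -> : ext_sign i (i |: S) = ext_sign i S.
  rewrite /ext_sign; apply: eq_card => k; rewrite !inE.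
  by case: eqVneq => [->|//]; rewrite ltnn !andbF.
by rewrite mulrCA mulrA.
Qed.

End Exterior.

(* [C[z', w'] (x) /\ C^n]: the variables [z'_i] and [w'_i] have indices
   [lshift n i] and [rshift n i]. *)
Definition poly_form (R : realType) (n : nat) : Type :=
  {ffun {set 'I_n} -> mpoly (n + n) R[i]}.

HB.instance Definition _ (R : realType) (n : nat) :=
  GRing.Lmodule.copy (poly_form R n) {ffun {set 'I_n} -> mpoly (n + n) R[i]}.

Section Tangential.
Context {R : realType} {n : nat}.
Implicit Types (q : R) (p : poly_form R n).

Definition form_norm2 q p : R :=
  \sum_(S : {set 'I_n}) \sum_(g <- msupp (p S))
    rnorm (mcoeff g (p S)) ^+ 2 * \prod_(k < n + n) qfact q (g k).

Definition form_jackson q (k : 'I_(n + n)) p : poly_form R n :=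
  [ffun S : {set 'I_n} => mjackson q k (p S)].

Definition form_D q p : poly_form R n :=
  \sum_(i < n) ext_mul i (form_jackson q (lshift n i) p).

Definition form_Dd q p : poly_form R n :=
  \sum_(i < n) ext_contr i (form_jackson q (rshift n i) p).

Context {X : completeNormedModType R[i]}.
Implicit Types (j : {linear poly_form R n -> X}) (T : X -> X).

Definition is_completion q j : Prop :=
  (forall p, rnorm (j p) = Num.sqrt (form_norm2 q p)) /\ dense (range j).

Definition bounded_op T : Prop :=
  exists M : R, forall x, rnorm (T x) <= M * rnorm x.

(* The bounded linear operator on the completion extending [T0]; it is
   unique by density. *)
Definition bounded_ext j (T0 : poly_form R n -> poly_form R n) : X -> X :=
  get [set T | [/\ linear T, bounded_op T & forall p, T (j p) = j (T0 p)]].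

Definition opD q j : X -> X := bounded_ext j (form_D q).

Definition opDd q j : X -> X := bounded_ext j (form_Dd q).

Definition opnorm T : R := sup [set rnorm (T x) | x in [set x | rnorm x <= 1]].

Definition mu_q q j : R :=
  Num.max (opnorm (opD q j \o opDd q j)) (opnorm (opDd q j \o opD q j)).

End Tangential.

Section DividedPowerSeries.
Context {R : realType} {X : completeNormedModType R[i]}.
Implicit Types (q rho : R) (z w : R[i]) (u : nat -> X) (c : nat -> nat -> X).

Definition dp_norm q rho u : \bar R :=
  (\sum_(0 <= k <oo) (rho ^+ k / qfact q k * rnorm (u k))%:E)%E.

(* [u] is the sequence of coefficients of an element of [A_q(rho; X)]. *)
Definition in_A q rho u : Prop := (dp_norm q rho u < +oo)%E.

Definition dp_sum1 q u z : X := limn (series (fun k => dpow q z k *: u k)).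

Definition dp_term2 q c z w (rs : nat * nat) : X :=
  (dpow q z rs.1 * dpow q w rs.2) *: c rs.1 rs.2.

Definition dp_sum2 q c z w : X := summability.sum (dp_term2 q c z w).

Definition normal_cvg q (rho_z rho_w : R) c : Prop :=
  (\esum_(rs in [set: nat * nat])
     (rho_z ^+ rs.1 * rho_w ^+ rs.2 / (qfact q rs.1 * qfact q rs.2)
        * rnorm (c rs.1 rs.2))%:E < +oo)%E.

Definition bidisc (rho_z rho_w : R) : set (R[i] * R[i]) :=
  [set zw | `|zw.1| <= rho_z%:C /\ `|zw.2| <= rho_w%:C].

Definition dp_expansion q (rho_z rho_w : R) c (F : R[i] -> R[i] -> X) : Prop :=
  normal_cvg q rho_z rho_w c /\
  forall z w, bidisc rho_z rho_w (z, w) ->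
    partial_sum (dp_term2 q c z w) J @[J --> totally] --> F z w.

Definition dp_class q (rho_z rho_w : R) (F : R[i] -> R[i] -> X) : Prop :=
  exists c, dp_expansion q rho_z rho_w c F.

Definition jackson_quot q (f : R[i] -> X) z : X :=
  ((q - 1)%:C * z)^-1 *: (f (q%:C * z) - f z).

(* Extended by continuity at 0. *)
Definition jackson q (f : R[i] -> X) z : X :=
  if z == 0 then lim (jackson_quot q f h @[h --> (0 : R[i]^o)^'])
  else jackson_quot q f z.

End DividedPowerSeries.

Section JointMonogenic.
Context {R : realType} {n : nat} {X : completeNormedModType R[i]}.
Variables (q : R) (j : {linear poly_form R n -> X}) (rho_z rho_w : R).

(* [D_q f = 0] on the bidisc for [f = A + eps_m B]: the components free of
   [eps_m] and along [eps_m] of [(D'_q + eps_m D_{q,z_m}) f], where [eps_m]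
   anticommutes with [eps_i] and [iota_i] for [i < m]. *)
Definition Dq_null (A B : R[i] -> R[i] -> X) : Prop :=
  forall z w, bidisc rho_z rho_w (z, w) ->
    opD q j (A z w) = 0 /\ jackson q (A ^~ w) z = opD q j (B z w).

(* likewise for [(D_q^dagger' + iota_m D_{q,w_m}) f] *)
Definition Dqd_null (A B : R[i] -> R[i] -> X) : Prop :=
  forall z w, bidisc rho_z rho_w (z, w) ->
    opDd q j (B z w) = 0 /\ jackson q (B z) w = - opDd q j (A z w).

Definition joint_monogenic (A B : R[i] -> R[i] -> X) : Prop :=
  Dq_null A B /\ Dqd_null A B.

(* [A|_(z_m = 0) = a(w_m)] and [B|_(w_m = 0) = b(z_m)] *)
Definition two_face_data (a b : nat -> X) (A B : R[i] -> R[i] -> X) : Prop :=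
  (forall w, `|w| <= rho_w%:C -> A 0 w = dp_sum1 q a w) /\
  (forall z, `|z| <= rho_z%:C -> B z 0 = dp_sum1 q b z).

End JointMonogenic.

Section Extension.
Context {R : realType} {n : nat} {X : completeNormedModType R[i]}.
Variables (q : R) (j : {linear poly_form R n -> X}) (a b : nat -> X).

Fixpoint extcoefA (r s : nat) : X :=
  if r is r'.+1 then
    opD q j (if s is s'.+1 then - opDd q j (extcoefA r' s') else b r')
  else a s.

Definition extcoefB (r s : nat) : X :=
  if s is s'.+1 then - opDd q j (extcoefA r s') else b r.

Lemma extcoefA0 s : extcoefA 0 s = a s. Proof. by []. Qed.
Lemma extcoefB0 r : extcoefB r 0 = b r. Proof. by case: r. Qed.
Lemma extcoefAS r s : extcoefA r.+1 s = opD q j (extcoefB r s). Proof. by []. Qed.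
Lemma extcoefBS r s : extcoefB r s.+1 = - opDd q j (extcoefA r s). Proof. by []. Qed.

Definition extA : R[i] -> R[i] -> X := dp_sum2 q extcoefA.

Definition extB : R[i] -> R[i] -> X := dp_sum2 q extcoefB.

Definition boundary_data (Rz Rw : R) : Prop :=
  [/\ in_A q Rw a, forall s, opD q j (a s) = 0,
      in_A q Rz b & forall r, opDd q j (b r) = 0].

End Extension.

(* Main.v *)
Require Import Defs.
From HB Require Import structures.
From mathcomp Require Import all_boot all_order all_algebra complex.
From mathcomp Require Import all_classical all_reals all_analysis.
From mathcomp Require Import finmap summability ring lra.

(** Along a diagonal [s - r = const] the recursion reads
    [A_(r+1,s+1) = - D' D^dag' A_(r,s)] (and [B] likewise), so
    [|A_(k+r,k+s)| <= mu^k |A_(r,s)|]; as [k]_q! [r]_q! <= [k+r]_q!, summing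
    along diagonals bounds the norm series of [A] by [Phi_q (mu rho_z rho_w)]
    times the norms of its two edges [A_(0,s) = a_s], [A_(r+1,0) = D' b_r].
    On normally convergent divided-power series the Jackson derivative shifts
    the coefficients, so monogenicity is the recursion itself.  A series
    vanishing on the bidisc has zero coefficients, because all its iterated
    Jackson derivatives vanish at the origin; hence the recursion and the face
    data determine the solution. *)

Set Implicit Arguments.
Unset Strict Implicit.
Unset Printing Implicit Defensive.

Import Order.TTheory GRing.Theory Num.Theory.

Local Open Scope classical_set_scope.
Local Open Scope ring_scope.
Local Open Scope complex_scope.

(* The tangential operators are picked by [get] among bounded extensions, so they have usable
   properties only once some bounded extension is exhibited. On polynomial forms each Jackson
   derivative is bounded because [[k]_q <= 1/(1-q)]; density carries this to the completion,
   together with the fact that both operators square to zero, which comes from anticommuting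
   exterior factors and commuting derivatives. These squares propagate [D' A = 0] and [D^dag' B = 0]
   from the faces to the whole bidisc. Since [[k]_q] tends to [1/(1-q)], the threshold [(1-q)^-2] is
   the radius of convergence of [Phi]; the square of [[k]_q!] there pays for one q-factorial in each
   variable. The two-face problem itself is solved for an abstract pair of bounded operators [S],
   [U] of square zero, with [U] standing for [- D^dag']: with the sign absorbed, exchanging the
   variables exchanges A and B, so the diagonal estimate is proved once. Sums run over finite sets
   of index pairs, which turns exchanging the variables, shifting an index and restricting to a face
   into one reindexing argument. *)
#[local] Existing Instance totally_filter.

(** * Real-valued norms on complex normed spaces *)

Section RealNorm.
Context {R : realType}.

Section Zmod.
Context {V : normedZmodType R[i]}.
Implicit Types x y : V.

Lemma normr_rnorm x : `|x| = (rnorm x)%:C.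
Proof. by rewrite /rnorm RRe_real // ger0_real. Qed.

Lemma rnorm_ge0 x : 0 <= rnorm x.
Proof. by rewrite -ler0c -normr_rnorm normr_ge0. Qed.

Lemma rnorm0 : rnorm (0 : V) = 0.
Proof. by rewrite /rnorm normr0. Qed.

Lemma rnorm_eq0 x : (rnorm x == 0) = (x == 0).
Proof. by rewrite -[RHS]normr_eq0 normr_rnorm -(inj_eq (@complexI R)). Qed.

Lemma rnormN x : rnorm (- x) = rnorm x.
Proof. by rewrite /rnorm normrN. Qed.

Lemma rdistC x y : rnorm (x - y) = rnorm (y - x).
Proof. by rewrite /rnorm distrC. Qed.

Lemma ler_rnormD x y : rnorm (x + y) <= rnorm x + rnorm y.
Proof. by rewrite -lecR rmorphD /= -!normr_rnorm ler_normD. Qed.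

Lemma ler_rnormB x y : rnorm (x - y) <= rnorm x + rnorm y.
Proof. by rewrite -[in leRHS](rnormN y) ler_rnormD. Qed.

Lemma ler_rnorm_sum (I : Type) (r : seq I) (P : pred I) (F : I -> V) :
  rnorm (\sum_(i <- r | P i) F i) <= \sum_(i <- r | P i) rnorm (F i).
Proof.
elim/big_ind2 : _ => [|x a y b xa yb|//]; first by rewrite rnorm0.
by rewrite (le_trans (ler_rnormD _ _))// lerD.
Qed.

End Zmod.

Lemma rnormr (r : R) : rnorm (r%:C) = `|r|.
Proof. by rewrite /rnorm normc_def /= expr0n addr0 sqrtr_sqr. Qed.

Lemma rnormM (x y : R[i]) : rnorm (x * y) = rnorm x * rnorm y.
Proof.
by apply: (@complexI R); rewrite rmorphM /= -!normr_rnorm normrM.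
Qed.

Lemma rnormX (x : R[i]) k : rnorm (x ^+ k) = rnorm x ^+ k.
Proof.
by apply: (@complexI R); rewrite rmorphXn /= -!normr_rnorm normrX.
Qed.

Lemma rnormV (x : R[i]) : rnorm (x^-1) = (rnorm x)^-1.
Proof.
by apply: (@complexI R); rewrite fmorphV /= -!normr_rnorm normfV.
Qed.

Lemma ler_rnormc (x : R[i]) (r : R) : (`|x| <= r%:C) = (rnorm x <= r).
Proof. by rewrite normr_rnorm lecR. Qed.

Lemma rnormZ {V : normedModType R[i]} (c : R[i]) (x : V) :
  rnorm (c *: x) = rnorm c * rnorm x.
Proof.
by apply: (@complexI R); rewrite rmorphM /= -!normr_rnorm normrZ.
Qed.

Lemma rnorm_cvgP {V : normedModType R[i]} {T : Type} {F : set_system T}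
    {FF : Filter F} (f : T -> V) (l : V) :
  f x @[x --> F] --> l <->
  (forall e : R, 0 < e -> \forall x \near F, rnorm (l - f x) < e).
Proof.
split=> [/cvgrPdist_lt fl e e0|fl].
  have := fl e%:C; rewrite ltcR => /(_ e0).
  by apply: filterS => x; rewrite normr_rnorm ltcR.
apply/cvgrPdist_lt => e; case: e => er ei.
(* In the order of [R[i]], positivity forces the imaginary part to vanish, so real tolerances
   suffice. *)
rewrite ltcE /= => /andP[/eqP -> e0].
by apply: filterS (fl _ e0) => x; rewrite normr_rnorm ltcR.
Qed.

Lemma rnorm_cvg_le {V : normedModType R[i]} {T : Type} {F : set_system T}
    {FF : ProperFilter F} (f : T -> V) (l : V) (M : R) :
  f x @[x --> F] --> l -> (\forall x \near F, rnorm (f x) <= M) ->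
  rnorm l <= M.
Proof.
move=> /rnorm_cvgP fl fM; apply/ler_addgt0Pr => e e0.
have [x [lx fx]] := filter_ex (filterI (fl _ e0) fM).
rewrite -(subrK (f x) l) (le_trans (ler_rnormD _ _))// addrC lerD//.
exact: ltW.
Qed.

Lemma rnorm_lt_eq0 {V : normedZmodType R[i]} (x : V) :
  (forall e : R, 0 < e -> rnorm x <= e) -> x = 0.
Proof.
move=> xe; apply/eqP; rewrite -rnorm_eq0 eq_le rnorm_ge0 andbT.
by apply/ler_addgt0Pr => e e0; rewrite add0r xe.
Qed.

End RealNorm.

(** * Finite sums and summability of nonnegative families *)

Lemma big_uniq_subset (V : nmodType) (I : eqType) (s t : seq I) (g : I -> V) :
  uniq s -> uniq t -> {subset s <= t} ->
  \sum_(i <- t) g i = \sum_(i <- s) g i + \sum_(i <- t | i \notin s) g i.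
Proof.
move=> us ut st; rewrite (bigID (mem s))/=; congr (_ + _).
rewrite -big_filter; apply: perm_big; apply: uniq_perm => //.
  exact: filter_uniq.
by move=> i; rewrite mem_filter/=; case: (boolP (i \in s)) => //= /st ->.
Qed.

Lemma ler_sum_subset {R : realType} (I : eqType) (s t : seq I) (g : I -> R) :
  uniq s -> uniq t -> {subset s <= t} -> (forall i, 0 <= g i) ->
  \sum_(i <- s) g i <= \sum_(i <- t) g i.
Proof.
by move=> us ut st g0; rewrite (big_uniq_subset g us ut st) lerDl sumr_ge0.
Qed.

(** Replaces an extended-real sum by a uniform bound on finite sums; normal convergence is used in
    this form throughout. *)
Lemma esum_ltyP {R : realType} {I : choiceType} (g : I -> R) :
  (forall i, 0 <= g i) ->
  (\esum_(i in [set: I]) (g i)%:E < +oo)%E <->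
  exists M : R, forall J : {fset I}, \sum_(i <- J) g i <= M.
Proof.
move=> g0; split=> [goo|[M gM]].
  exists (fine (\esum_(i in [set: I]) (g i)%:E)) => J.
  have e0 : (0 <= \esum_(i in [set: I]) (g i)%:E)%E.
    by apply: esum_ge0 => i _; rewrite lee_fin.
  rewrite -lee_fin fineK; last by rewrite ge0_fin_numE.
  apply: ereal_sup_ubound; exists [set` J]; first by split.
  by rewrite fsbig_finite//= set_fsetK sumEFin.
apply: (@le_lt_trans _ _ M%:E); last exact: ltry.
apply: ge_ereal_sup => _ [A [finA _] <-].
by rewrite fsbig_finite//= sumEFin lee_fin.
Qed.

(** * Unordered sums in a Banach space *)

Section Families.
Context {R : realType} {X : completeNormedModType R[i]}.

(** Convergence along the directed set of finite index sets, hence insensitive to the order of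
    summation. *)
Definition has_sum {I : choiceType} (f : I -> X) (l : X) :=
  partial_sum f J @[J --> totally] --> l.

Lemma partial_sumE {I : choiceType} (f : I -> X) J :
  partial_sum f J = \sum_(i <- J) f i.
Proof. by rewrite /partial_sum (big_seq_fsetE _ _ predT). Qed.

Lemma has_sumP {I : choiceType} (f : I -> X) (l : X) :
  has_sum f l <-> forall e : R, 0 < e -> exists J0 : {fset I},
    forall J, (J0 `<=` J)%fset -> rnorm (l - \sum_(i <- J) f i) < e.
Proof.
split=> [fl e e0|H].
  have [J0 _ HJ] := (rnorm_cvgP _ _).1 fl e e0.
  by exists J0 => J /HJ /=; rewrite partial_sumE.
apply/rnorm_cvgP => e /H.
by move=> [J0 HJ]; exists J0 => // J /HJ /=; rewrite partial_sumE.
Qed.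

Lemma has_sum_unique {I : choiceType} (f : I -> X) (l l' : X) :
  has_sum f l -> has_sum f l' -> l = l'.
Proof. exact: cvg_unique. Qed.

Lemma has_sum_sum {I : choiceType} (f : I -> X) (l : X) :
  has_sum f l -> summability.sum f = l.
Proof. by move=> fl; apply: cvg_lim. Qed.

(** Cauchy criterion: if the norm sum over [J0] is within the tolerance of the supremum of all
    finite norm sums, the terms outside [J0] have total norm below the tolerance. *)
Lemma has_sum_exists {I : choiceType} (f : I -> X) (M : R) :
  (forall J : {fset I}, \sum_(i <- J) rnorm (f i) <= M) ->
  has_sum f (summability.sum f).
Proof.
move=> fM; rewrite /has_sum /summability.sum.
suff /cvg_ex [l fl] : cvg (partial_sum f @ totally) by rewrite (cvg_lim _ fl).
apply: cauchy_cvg; apply/cauchy_exP => e.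
case: e => er ei; rewrite ltcE /= => /andP[/eqP -> e0].
pose S := [set \sum_(i <- J) rnorm (f i) | J in [set: {fset I}]].
have supS : has_sup S.
  split; first by exists (\sum_(i <- fset0) rnorm (f i)), fset0.
  by exists M => _ [J _ <-].
have [_ [J0 _ <-] HJ0] := sup_adherent e0 supS.
exists (partial_sum f J0), J0 => // J J0J.
rewrite -ball_normE /= normr_rnorm ltcR rdistC !partial_sumE.
rewrite (big_uniq_subset f (fset_uniq J0) (fset_uniq J)); last exact/fsubsetP.
rewrite addrC addKr (le_lt_trans (ler_rnorm_sum _ _ _))//.
have : \sum_(i <- J) rnorm (f i) <= sup S.
  by apply: sup_upper_bound => //; exists J.
rewrite (big_uniq_subset _ (fset_uniq J0) (fset_uniq J)); last exact/fsubsetP.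
by move=> H; lra.
Qed.

Lemma has_sum_le {I : choiceType} (f : I -> X) l (M : R) :
  has_sum f l -> (forall J : {fset I}, \sum_(i <- J) rnorm (f i) <= M) ->
  rnorm l <= M.
Proof.
move=> fl fM; apply: (rnorm_cvg_le fl); apply: nearW => J.
by rewrite partial_sumE (le_trans (ler_rnorm_sum _ _ _)).
Qed.

Lemma has_sumB {I : choiceType} (f g : I -> X) l k :
  has_sum f l -> has_sum g k -> has_sum (fun i => f i - g i) (l - k).
Proof.
move=> fl gk; rewrite /has_sum; under eq_fun do rewrite partial_sumE sumrB.
by apply: cvgB; under eq_fun do rewrite -partial_sumE.
Qed.

Lemma has_sum_linear {I : choiceType} (T : {linear X -> X}) (f : I -> X) l M :
  (forall x, rnorm (T x) <= M * rnorm x) ->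
  has_sum f l -> has_sum (T \o f) (T l).
Proof.
move=> TM /has_sumP fl; apply/has_sumP => e e0.
have M1 : 0 < `|M| + 1 by rewrite ltr_pwDr.
have [J0 H] := fl _ (divr_gt0 e0 M1); exists J0 => J /H.
rewrite -linear_sum -linearB ltr_pdivlMr// mulrC; apply: le_lt_trans.
rewrite (le_trans (TM _))// ler_wpM2r ?rnorm_ge0//.
by rewrite (le_trans (ler_norm M))// lerDl.
Qed.

Lemma has_sumZ {I : choiceType} (c : R[i]) (f : I -> X) l :
  has_sum f l -> has_sum (fun i => c *: f i) (c *: l).
Proof.
rewrite /has_sum => fl; under eq_fun do rewrite partial_sumE -scaler_sumr.
by apply: cvgZr; under eq_fun do rewrite -partial_sumE.
Qed.

(** It is enough that the image of [e] contains the support of [f]. If [J] contains the preimage of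
    [J0], an index of [J0] not in the image of [J] lies outside the range of [e], where [f]
    vanishes; so [J0] can be adjoined to that image without changing the sum. *)
Lemma has_sum_reindex {I K : choiceType} (e : K -> I) (f : I -> X) l :
  injective e -> (forall i, f i != 0 -> exists k, i = e k) ->
  has_sum f l -> has_sum (f \o e) l.
Proof.
move=> einj fe /has_sumP fl; apply/has_sumP => eps /fl [J0 H].
have fin : finite_set (e @^-1` [set` J0]).
  by apply: finite_preimage => // ? ? _ _; apply: einj.
exists (fset_set (e @^-1` [set` J0])) => J J0J.
pose eJ := [fset e k | k in J]%fset.
have -> : \sum_(k <- J) (f \o e) k = \sum_(i <- (J0 `|` eJ)%fset) f i.
  rewrite -(@big_fset_incl _ _ _ _ eJ) ?fsubsetUr//.
    by rewrite big_imfset//= => ? ? _ _; apply: einj.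
  move=> i /fsetUP[iJ0|->//] ieJ.
  apply/eqP; apply: contraNT ieJ => /fe [k ik]; rewrite ik.
  apply/imfsetP; exists k => //=; apply: (fsubsetP J0J).
  by rewrite in_fset_set//; apply/mem_set; rewrite /= -ik.
by apply: H; rewrite fsubsetUl.
Qed.

Lemma has_sum_series (f : nat -> X) l : has_sum f l -> series f n @[n --> \oo] --> l.
Proof.
move=> /has_sumP fl; apply/rnorm_cvgP => e /fl [J0 H].
(* Beyond every index in [J0], an initial segment contains [J0]. *)
pose n0 := (\max_(k <- J0) k).+1.
exists n0 => // n /= n0n.
pose J := [fset k | k in iota 0 n]%fset.
have -> : series f n = \sum_(k <- J) f k.
  rewrite /series /= big_imfset; last by [].
  by rewrite /= undup_id ?iota_uniq// /index_iota subn0.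
apply: H; apply/fsubsetP => k kJ; apply/imfsetP; exists k => //=.
rewrite mem_iota add0n (leq_trans _ n0n)//= ltnS.
by rewrite (big_rem k)//= leq_maxl.
Qed.

End Families.

(** * q-numbers, q-factorials and divided powers *)

Section QNumberTheory.
Context {R : realType}.
Implicit Types (q : R) (r s k : nat).

Lemma qnum0 q : qnum q 0 = 0.
Proof. by rewrite /qnum expr0 subrr mul0r. Qed.

Lemma ler_qnum q r s : 0 < q < 1 -> (r <= s)%N -> qnum q r <= qnum q s.
Proof.
move=> /andP[q0 q1] rs; rewrite ler_pM2r ?invr_gt0 ?subr_gt0// lerD2l lerN2.
by rewrite ler_wiXn2l// ltW.
Qed.

Lemma qnum1 q : q < 1 -> qnum q 1 = 1.
Proof. by move=> q1; rewrite /qnum expr1 divff// subr_eq0 gt_eqF. Qed.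

Lemma qnumS_ge1 q r : 0 < q < 1 -> 1 <= qnum q r.+1.
Proof.
by move=> q01; rewrite -{1}(qnum1 (q := q)) ?ler_qnum//; case/andP: q01.
Qed.

Lemma qnumS_gt0 q r : 0 < q < 1 -> 0 < qnum q r.+1.
Proof. by move=> q01; apply: lt_le_trans (qnumS_ge1 r q01). Qed.

Lemma qnum_ge0 q r : 0 < q < 1 -> 0 <= qnum q r.
Proof. by case: r => [|r q01]; rewrite ?qnum0// ltW// qnumS_gt0. Qed.

(** This uniform bound makes Jackson derivatives bounded operators and lets a shifted series
    converge normally on the same bidisc. *)
Lemma qnum_le q r : 0 < q < 1 -> qnum q r <= (1 - q)^-1.
Proof.
move=> /andP[q0 q1]; rewrite ler_pdivrMr ?subr_gt0// mulVf; last first.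
  by rewrite subr_eq0 gt_eqF.
by rewrite gerBl exprn_ge0// ltW.
Qed.

Lemma qfact0 q : qfact q 0 = 1.
Proof. by rewrite /qfact big_nil. Qed.

Lemma qfactS q r : qfact q r.+1 = qfact q r * qnum q r.+1.
Proof. by rewrite /qfact big_nat_recr. Qed.

Lemma qfact_gt0 q r : 0 < q < 1 -> 0 < qfact q r.
Proof.
move=> q01; elim: r => [|r IH]; first by rewrite qfact0.
by rewrite qfactS mulr_gt0// qnumS_gt0.
Qed.

(** Equivalently, q-binomial coefficients are at least 1; inductively, [[r+1]_q <= [r+s+1]_q]. *)
Lemma qfactD_ge q r s : 0 < q < 1 -> qfact q r * qfact q s <= qfact q (r + s).
Proof.
move=> q01; elim: r => [|r IH]; first by rewrite qfact0 mul1r.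
rewrite addSn !qfactS mulrAC ler_pM ?qnum_ge0 ?ler_qnum// ?mulr_ge0//.
all: by rewrite ?ltnS ?leq_addr// ltW ?qfact_gt0.
Qed.

Lemma dpow0 q (z : R[i]) : dpow q z 0 = 1.
Proof. by rewrite /dpow qfact0 expr0 divr1. Qed.

Lemma dpow0S q r : dpow q (0 : R[i]) r.+1 = 0.
Proof. by rewrite /dpow expr0n mul0r. Qed.

Lemma rnorm_dpow q (z : R[i]) r : 0 < q < 1 ->
  rnorm (dpow q z r) = rnorm z ^+ r / qfact q r.
Proof.
move=> q01; rewrite /dpow rnormM rnormV rnormX rnormr ger0_norm//.
by rewrite ltW ?qfact_gt0.
Qed.

Lemma dpow_jackson q (z : R[i]) r : 0 < q < 1 -> z != 0 ->
  ((q - 1)%:C * z)^-1 * (dpow q (q%:C * z) r.+1 - dpow q z r.+1)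
  = dpow q z r.
Proof.
move=> q01 z0; have q1 : (q - 1)%:C != 0 :> R[i].
  by rewrite eq_complex /= eqxx andbT subr_eq0 lt_eqF//; case/andP: q01.
have f0 : (qfact q r)%:C != 0 :> R[i].
  by rewrite eq_complex /= eqxx andbT gt_eqF ?qfact_gt0.
have n0 : (qnum q r.+1)%:C != 0 :> R[i].
  by rewrite eq_complex /= eqxx andbT gt_eqF ?qnumS_gt0.
have -> : dpow q (q%:C * z) r.+1 - dpow q z r.+1
    = (q ^+ r.+1 - 1)%:C * z ^+ r.+1 / (qfact q r.+1)%:C.
  by rewrite /dpow rmorphB rmorphXn rmorph1 exprMn_comm /=; [ring|exact: mulrC].
have -> : (q ^+ r.+1 - 1)%:C = (qnum q r.+1)%:C * (q - 1)%:C :> R[i].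
  rewrite -rmorphM; congr (_%:C); rewrite /qnum; field.
  by rewrite subr_eq0 gt_eqF//; case/andP: q01.
have fS : (qfact q r.+1)%:C = (qfact q r)%:C * (qnum q r.+1)%:C :> R[i].
  by rewrite qfactS -rmorphM.
rewrite /dpow fS exprS; move: q1 f0 n0; move: (q - 1)%:C (qfact q r)%:C.
move: (qnum q r.+1)%:C => n Q f q1 f0 n0; field.
by rewrite q1 z0 f0 n0.
Qed.

End QNumberTheory.

(** * Normally convergent double series and their Jackson derivatives *)

Section DoubleSeries.
Context {R : realType} {X : completeNormedModType R[i]}.
Variables (q : R) (q01 : 0 < q < 1).
Implicit Types (rz rw : R) (z w : R[i]) (c d : nat -> nat -> X) (u : nat -> X).

(** The modulus of the divided-power monomial of bidegree [rs] on the torus of radii [rz], [rw]. *)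
Definition dp_weight rz rw (rs : nat * nat) : R :=
  rz ^+ rs.1 * rw ^+ rs.2 / (qfact q rs.1 * qfact q rs.2).

Definition shift_z c r s := c r.+1 s.
Definition swap_zw c r s := c s r.

Lemma dp_weight_ge0 rz rw rs : 0 <= rz -> 0 <= rw -> 0 <= dp_weight rz rw rs.
Proof.
move=> rz0 rw0; rewrite /dp_weight mulr_ge0 ?invr_ge0 ?mulr_ge0 ?exprn_ge0//.
all: by rewrite ltW ?qfact_gt0.
Qed.

Lemma normal_cvgP rz rw c : 0 <= rz -> 0 <= rw ->
  normal_cvg q rz rw c <-> exists M : R, forall J : {fset nat * nat},
    \sum_(rs <- J) dp_weight rz rw rs * rnorm (c rs.1 rs.2) <= M.
Proof.
move=> rz0 rw0.
apply: (esum_ltyP (g := fun rs => dp_weight rz rw rs * rnorm (c rs.1 rs.2))).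
by move=> rs; rewrite mulr_ge0 ?dp_weight_ge0 ?rnorm_ge0.
Qed.

Lemma rnorm_dp_term2 c z w rs :
  rnorm (dp_term2 q c z w rs)
  = dp_weight (rnorm z) (rnorm w) rs * rnorm (c rs.1 rs.2).
Proof.
by rewrite /dp_term2 rnormZ rnormM !rnorm_dpow// /dp_weight mulf_div.
Qed.

Lemma ler_dp_weight rz rw rz' rw' rs : 0 <= rz <= rz' -> 0 <= rw <= rw' ->
  dp_weight rz rw rs <= dp_weight rz' rw' rs.
Proof.
move=> /andP[z0 zz] /andP[w0 ww]; rewrite ler_pM2r ?invr_gt0 ?mulr_gt0 ?qfact_gt0//.
by rewrite ler_pM ?exprn_ge0// lerXn2r// nnegrE (le_trans _ zz, le_trans _ ww).
Qed.

Lemma bidiscE rz rw z w : bidisc rz rw (z, w) <-> rnorm z <= rz /\ rnorm w <= rw.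
Proof. by rewrite /bidisc /= !ler_rnormc. Qed.

Lemma ler_rnorm_dp_term2 rz rw c z w rs : bidisc rz rw (z, w) ->
  rnorm (dp_term2 q c z w rs) <= dp_weight rz rw rs * rnorm (c rs.1 rs.2).
Proof.
move=> /bidiscE[zz ww]; rewrite rnorm_dp_term2 ler_wpM2r ?rnorm_ge0//.
by rewrite ler_dp_weight ?rnorm_ge0.
Qed.

Lemma ler_sum_dp_term2 rz rw c z w (M : R) (J : {fset nat * nat}) :
  bidisc rz rw (z, w) ->
  \sum_(rs <- J) dp_weight rz rw rs * rnorm (c rs.1 rs.2) <= M ->
  \sum_(rs <- J) rnorm (dp_term2 q c z w rs) <= M.
Proof.
move=> zw; apply: le_trans; apply: ler_sum => rs _.
exact: ler_rnorm_dp_term2.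
Qed.

Lemma bidisc_ge0 rz rw z w : bidisc rz rw (z, w) -> 0 <= rz /\ 0 <= rw.
Proof.
by move=> /bidiscE[zz ww]; split; apply: le_trans (rnorm_ge0 _) _; eassumption.
Qed.

Lemma has_dp_sum2 rz rw c z w : normal_cvg q rz rw c -> bidisc rz rw (z, w) ->
  has_sum (dp_term2 q c z w) (dp_sum2 q c z w).
Proof.
move=> cM zw; have [z0 w0] := bidisc_ge0 zw.
have [M HM] := (normal_cvgP c z0 w0).1 cM.
by apply: (has_sum_exists (M := M)) => J; apply: ler_sum_dp_term2 (HM J).
Qed.

Lemma dp_expansion_sum2 rz rw c : normal_cvg q rz rw c ->
  dp_expansion q rz rw c (dp_sum2 q c).
Proof. by move=> cM; split=> // z w /(has_dp_sum2 cM). Qed.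

Lemma dp_expansionE rz rw c F : dp_expansion q rz rw c F ->
  forall z w, bidisc rz rw (z, w) -> F z w = dp_sum2 q c z w.
Proof.
move=> [cM cF] z w zw; apply: (@has_sum_unique R X _ (dp_term2 q c z w)).
  exact: cF.
exact: has_dp_sum2 cM zw.
Qed.

Lemma rnorm_dp_sum2 rz rw c z w (M : R) :
  (forall J : {fset nat * nat},
     \sum_(rs <- J) dp_weight rz rw rs * rnorm (c rs.1 rs.2) <= M) ->
  bidisc rz rw (z, w) -> rnorm (dp_sum2 q c z w) <= M.
Proof.
move=> HM zw; have [z0 w0] := bidisc_ge0 zw.
have cM : normal_cvg q rz rw c by apply/normal_cvgP => //; exists M.
apply: (has_sum_le (has_dp_sum2 cM zw)) => J.
exact: ler_sum_dp_term2 (HM J).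
Qed.

Lemma normal_cvgB rz rw c d : 0 <= rz -> 0 <= rw ->
  normal_cvg q rz rw c -> normal_cvg q rz rw d ->
  normal_cvg q rz rw (fun r s => c r s - d r s).
Proof.
move=> z0 w0 /(normal_cvgP _ z0 w0)[M cM] /(normal_cvgP _ z0 w0)[N dN].
apply/normal_cvgP => //; exists (M + N) => J.
apply: le_trans (lerD (cM J) (dN J)); rewrite -big_split /=.
apply: ler_sum => rs _; rewrite -mulrDr ler_wpM2l ?dp_weight_ge0//.
exact: ler_rnormB.
Qed.

Lemma dp_sum2B rz rw c d z w :
  normal_cvg q rz rw c -> normal_cvg q rz rw d -> bidisc rz rw (z, w) ->
  dp_sum2 q (fun r s => c r s - d r s) z w
  = dp_sum2 q c z w - dp_sum2 q d z w.
Proof.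
move=> cM dM zw; have [z0 w0] := bidisc_ge0 zw.
apply: has_sum_sum.
have := has_sumB (has_dp_sum2 cM zw) (has_dp_sum2 dM zw).
by congr has_sum; apply/funext => rs; rewrite /dp_term2 scalerBr.
Qed.

Lemma normal_cvg_linear rz rw c (T : {linear X -> X}) (M : R) :
  0 <= rz -> 0 <= rw -> (forall x, rnorm (T x) <= M * rnorm x) ->
  normal_cvg q rz rw c -> normal_cvg q rz rw (fun r s => T (c r s)).
Proof.
move=> z0 w0 TM /(normal_cvgP _ z0 w0)[N cN].
apply/normal_cvgP => //; exists (`|M| * N) => J.
apply: le_trans (ler_wpM2l (normr_ge0 M) (cN J)); rewrite mulr_sumr.
apply: ler_sum => rs _; rewrite mulrCA ler_wpM2l ?dp_weight_ge0//.
by rewrite (le_trans (TM _))// ler_wpM2r ?rnorm_ge0 ?ler_norm.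
Qed.

Lemma dp_sum2_linear rz rw c (T : {linear X -> X}) (M : R) z w :
  (forall x, rnorm (T x) <= M * rnorm x) ->
  normal_cvg q rz rw c -> bidisc rz rw (z, w) ->
  dp_sum2 q (fun r s => T (c r s)) z w = T (dp_sum2 q c z w).
Proof.
move=> TM cM zw; apply: has_sum_sum.
have := has_sum_linear TM (has_dp_sum2 cM zw).
by congr has_sum; apply/funext => rs; rewrite /= linearZ.
Qed.

Lemma dp_sum2_0 z w : dp_sum2 q (fun _ _ => 0 : X) z w = 0.
Proof.
apply: has_sum_sum; apply/has_sumP => e e0; exists fset0 => J _.
by rewrite big1 ?subrr ?rnorm0// => rs _; rewrite /dp_term2 scaler0.
Qed.

Lemma swap_inj : injective (fun rs : nat * nat => (rs.2, rs.1)).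
Proof. by move=> [? ?] [? ?] [-> ->]. Qed.

Lemma normal_cvg_swap rz rw c : 0 <= rz -> 0 <= rw ->
  normal_cvg q rz rw c -> normal_cvg q rw rz (swap_zw c).
Proof.
move=> z0 w0 /(normal_cvgP _ z0 w0)[M cM].
apply/normal_cvgP => //; exists M => J.
apply: le_trans (cM [fset (rs.2, rs.1) | rs in J]%fset).
rewrite big_imfset/=; last by move=> ? ? _ _; apply: swap_inj.
apply: ler_sum => rs _; rewrite /dp_weight /swap_zw /=.
by rewrite (mulrC (rz ^+ _)) (mulrC (qfact q rs.2)).
Qed.

Lemma dp_sum2_swap rz rw c z w : normal_cvg q rz rw c -> bidisc rz rw (z, w) ->
  dp_sum2 q (swap_zw c) w z = dp_sum2 q c z w.
Proof.
move=> cM zw; apply: has_sum_sum.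
have := has_sum_reindex swap_inj _ (has_dp_sum2 cM zw).
move=> /(_ (fun rs _ => ex_intro _ (rs.2, rs.1) (surjective_pairing rs))).
congr has_sum; apply/funext => rs; rewrite /= /dp_term2 /=.
by rewrite /swap_zw (mulrC (dpow _ w _)).
Qed.

(** At [z = 0] only the row [r = 0] survives, so the double sum reindexes to a single one, which is
    then read as an ordered series. *)
Lemma dp_sum2_face rz rw c w : normal_cvg q rz rw c -> bidisc rz rw (0, w) ->
  dp_sum2 q c 0 w = dp_sum1 q (c 0%N) w.
Proof.
move=> cM zw; apply/esym; apply: cvg_lim => //; apply: has_sum_series.
have inj : injective (fun s : nat => (0%N, s)) by move=> ? ? [].
have supp rs : dp_term2 q c 0 w rs != 0 -> exists s, rs = (0%N, s).
  case: rs => [[|r] s]; first by exists s.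
  by rewrite /dp_term2 /= dpow0S mul0r scale0r eqxx.
have := has_sum_reindex inj supp (has_dp_sum2 cM zw).
by congr has_sum; apply/funext => s; rewrite /= /dp_term2 /= dpow0 mul1r.
Qed.

(** Passing from index [r+1] to [r] multiplies the weight by [[r+1]_q / rz], which is at most
    [(rz * (1 - q))^-1]. The radii do not shrink. *)
Lemma normal_cvg_shift rz rw c : 0 < rz -> 0 <= rw ->
  normal_cvg q rz rw c -> normal_cvg q rz rw (shift_z c).
Proof.
move=> z0 w0 /(normal_cvgP _ (ltW z0) w0)[M cM].
apply/normal_cvgP; [exact: ltW|by []|exists ((rz * (1 - q))^-1 * M) => J].
have q1 : 0 < 1 - q by case/andP: q01 => _; rewrite subr_gt0.
rewrite ler_pdivlMl ?mulr_gt0//.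
apply: le_trans (cM [fset (rs.1.+1, rs.2) | rs in J]%fset).
rewrite big_imfset/=; last by move=> [? ?] [? ?] _ _ /= [-> ->].
rewrite mulr_sumr; apply: ler_sum => rs _; rewrite mulrA ler_wpM2r ?rnorm_ge0//.
rewrite /dp_weight /= exprS qfactS.
have := qfact_gt0 rs.1 q01; have := qfact_gt0 rs.2 q01.
have := qnumS_gt0 rs.1 q01; have := qnum_le rs.1.+1 q01.
set n := qnum _ _; set f := qfact _ _; set g := qfact _ _ => nq n0 f0 g0.
have -> : rz * rz ^+ rs.1 * rw ^+ rs.2 / (g * n * f)
  = n^-1 * (rz * (rz ^+ rs.1 * rw ^+ rs.2 / (g * f))).
  by field; rewrite !gt_eqF.
rewrite mulrAC mulrC ler_wpM2r ?mulr_ge0 ?exprn_ge0 ?invr_ge0 ?(ltW z0)//.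
  by rewrite mulr_ge0 ?ltW.
by rewrite -[1 - q]invrK lef_pV2 // posrE invr_gt0.
Qed.

(** A Schwarz-type estimate: the row [r = 0] cancels, and in every other row
    [|z|^(r+1) <= (|z| / rz) * rz^(r+1)]. It provides the continuity needed for the Jackson
    derivative at the origin. *)
Lemma dp_sum2_near0 rz rw c z w (M : R) : 0 < rz ->
  (forall J : {fset nat * nat},
     \sum_(rs <- J) dp_weight rz rw rs * rnorm (c rs.1 rs.2) <= M) ->
  bidisc rz rw (z, w) ->
  rnorm (dp_sum2 q c z w - dp_sum2 q c 0 w) <= rnorm z / rz * M.
Proof.
move=> rz0 HM zw; have [_ w0] := bidisc_ge0 zw.
have cM : normal_cvg q rz rw c by apply/normal_cvgP; [exact: ltW| |exists M].
have [zz ww] := (bidiscE _ _ _ _).1 zw.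
have zw0 : bidisc rz rw (0, w) by apply/bidiscE; rewrite rnorm0 ltW.
apply: (has_sum_le (has_sumB (has_dp_sum2 cM zw) (has_dp_sum2 cM zw0))) => J.
have t0 : 0 <= rnorm z / rz by rewrite divr_ge0 ?rnorm_ge0 ?ltW.
apply: le_trans (ler_wpM2l t0 (HM J)); rewrite mulr_sumr.
apply: ler_sum => -[[|r] s] _; rewrite /dp_term2 /= -scalerBl -mulrBl.
  rewrite !dpow0 subrr mul0r scale0r rnorm0 mulr_ge0//.
  by rewrite mulr_ge0 ?rnorm_ge0// dp_weight_ge0// ltW.
rewrite dpow0S subr0 rnormZ [leRHS]mulrA ler_wpM2r ?rnorm_ge0//.
rewrite rnormM !rnorm_dpow// /dp_weight /= mulf_div [leRHS]mulrA.
rewrite ler_pM2r; last first.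
  by rewrite invr_gt0 mulr_gt0 ?qfact_gt0.
rewrite !exprS -!mulrA ler_wpM2l ?rnorm_ge0//.
rewrite !mulrA mulVf ?gt_eqF// mul1r ler_pM ?exprn_ge0 ?rnorm_ge0//.
  by rewrite lerXn2r// nnegrE ?rnorm_ge0 ?ltW.
by rewrite lerXn2r// nnegrE ?rnorm_ge0.
Qed.

Lemma jackson_dp_expansion rz rw c (F : R[i] -> R[i] -> X) z w : 0 < rz ->
  normal_cvg q rz rw c ->
  (forall z w, bidisc rz rw (z, w) -> F z w = dp_sum2 q c z w) ->
  bidisc rz rw (z, w) ->
  jackson q (F ^~ w) z = dp_sum2 q (shift_z c) z w.
Proof.
move=> rz0 cM cF zw; have [_ w0] := bidisc_ge0 zw.
have sM := normal_cvg_shift rz0 w0 cM.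
(* Since [q < 1], the point [q h] stays in the disc, where [F] agrees with its series. The row
   [r = 0] cancels in the difference quotient, and the other rows are reindexed by [r + 1]. *)
have quot h : h != 0 -> rnorm h <= rz ->
    jackson_quot q (F ^~ w) h = dp_sum2 q (shift_z c) h w.
  move=> h0 hz; have [_ ww] := (bidiscE _ _ _ _).1 zw.
  have hw : bidisc rz rw (h, w) by apply/bidiscE.
  have qhw : bidisc rz rw (q%:C * h, w).
    apply/bidiscE; split=> //; rewrite rnormM rnormr.
    case/andP: q01 => q0 q1; rewrite gtr0_norm// (le_trans _ hz)//.
    by rewrite ler_piMl ?rnorm_ge0// ltW.
  rewrite /jackson_quot !cF//; apply/esym/has_sum_sum.
  have := has_sumB (has_dp_sum2 cM qhw) (has_dp_sum2 cM hw).
  move=> /(has_sumZ (c := ((q - 1)%:C * h)^-1)).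
  have inj : injective (fun rs : nat * nat => (rs.1.+1, rs.2)).
    by move=> [? ?] [? ?] /= [-> ->].
  move=> /(has_sum_reindex inj) H; have {H}/H : forall rs : nat * nat,
      ((q - 1)%:C * h)^-1 *: (dp_term2 q c (q%:C * h) w rs - dp_term2 q c h w rs)
      != 0 -> exists rs', rs = (rs'.1.+1, rs'.2).
    move=> [[|r] s]; last by exists (r, s).
    by rewrite /dp_term2 /= !dpow0 subrr scaler0 eqxx.
  congr has_sum; apply/funext => rs; rewrite /= /dp_term2 /= -scalerBl -mulrBl.
  by rewrite scalerA mulrA dpow_jackson.
rewrite /jackson; case: ifPn => [/eqP ->|z0]; last first.
  by apply: quot => //; case: ((bidiscE _ _ _ _).1 zw).
apply: cvg_lim => //; apply/rnorm_cvgP => e e0.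
have [M HM] := (normal_cvgP _ (ltW rz0) w0).1 sM.
have M0 : 0 <= M by have := HM fset0; rewrite big_seq_fset0.
have [_ ww] := (bidiscE _ _ _ _).1 zw.
(* At the origin the quotient is the shifted series, whose variation is at most [|h| / rz * M];
   hence this radius, with [M + 1] keeping the denominator positive. *)
have d0 : 0 < (Num.min rz (e * rz / (M + 1)))%:C :> R[i].
  by rewrite ltcR lt_min rz0 divr_gt0 ?mulr_gt0// ltr_wpDl.
near=> h.
have hd : rnorm h < Num.min rz (e * rz / (M + 1)).
  rewrite -ltcR -normr_rnorm; near: h.
  exact: (@dnbhs0_lt _ R[i]^o _ d0).
have h0 : h != 0 by near: h; exact: (@nbhs_dnbhs_neq R[i]^o 0).
have [hz he] : rnorm h < rz /\ rnorm h < e * rz / (M + 1).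
  by move: hd; rewrite lt_min => /andP[].
have hw : bidisc rz rw (h, w) by apply/bidiscE; rewrite ltW.
rewrite quot ?ltW// rdistC (le_lt_trans (dp_sum2_near0 rz0 HM hw))//.
move: he; rewrite ltr_pdivlMr ?ltr_wpDl// => he.
rewrite mulrAC ltr_pdivrMr// (le_lt_trans _ he)// ler_wpM2l ?rnorm_ge0//.
by rewrite lerDl.
Unshelve. all: by end_near.
Qed.

End DoubleSeries.

(** * Identity theorem for double divided-power series *)

Section UniquenessOfCoefficients.
Context {R : realType} {X : completeNormedModType R[i]}.
Variables (q : R) (q01 : 0 < q < 1).
Implicit Types (rz rw : R) (z w : R[i]) (c d : nat -> nat -> X).

Lemma bidisc_swap rz rw z w : bidisc rz rw (z, w) -> bidisc rw rz (w, z).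
Proof. by move=> []. Qed.

Lemma normal_cvgW rz rw rz' rw' c : 0 <= rz <= rz' -> 0 <= rw <= rw' ->
  normal_cvg q rz' rw' c -> normal_cvg q rz rw c.
Proof.
move=> zz ww; have [/andP[z0 z1] /andP[w0 w1]] := (zz, ww).
move=> /(normal_cvgP q01 _ (le_trans z0 z1) (le_trans w0 w1))[M cM].
apply/normal_cvgP => //; exists M => J; apply: le_trans (cM J).
by apply: ler_sum => rs _; rewrite ler_wpM2r ?rnorm_ge0 ?ler_dp_weight.
Qed.

Lemma dp_sum2_00 c : dp_sum2 q c 0 0 = c 0%N 0%N.
Proof.
apply: has_sum_sum; apply/has_sumP => e e0; exists [fset (0%N, 0%N)]%fset => J J0.
rewrite -(big_fset_incl _ J0) => [|[[|r] [|s]] _]; first 1 last.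
- by rewrite inE eqxx.
- by rewrite /dp_term2 /= dpow0S mulr0 scale0r.
- by rewrite /dp_term2 /= dpow0S mul0r scale0r.
- by rewrite /dp_term2 /= dpow0S mul0r scale0r.
by rewrite big_seq_fset1 /dp_term2 /= !dpow0 mulr1 scale1r subrr rnorm0.
Qed.

Lemma normal_cvg_shift_w rz rw c : 0 <= rz -> 0 < rw ->
  normal_cvg q rz rw c -> normal_cvg q rz rw (fun r s => c r s.+1).
Proof.
move=> z0 w0 /(normal_cvg_swap q01 z0 (ltW w0)).
by move=> /(normal_cvg_shift q01 w0 z0)/(normal_cvg_swap q01 (ltW w0) z0).
Qed.

Lemma jackson_dp_expansion_w rz rw c (F : R[i] -> R[i] -> X) z w : 0 < rw ->
  normal_cvg q rz rw c ->
  (forall z w, bidisc rz rw (z, w) -> F z w = dp_sum2 q c z w) ->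
  bidisc rz rw (z, w) ->
  jackson q (F z) w = dp_sum2 q (fun r s => c r s.+1) z w.
Proof.
move=> rw0 cM cF zw; have [z0 _] := bidisc_ge0 zw.
have sM := normal_cvg_swap q01 z0 (ltW rw0) cM.
rewrite (jackson_dp_expansion (F := fun w z => F z w) q01 rw0 sM)//.
- have sM' := normal_cvg_shift q01 rw0 z0 sM.
  by rewrite -(dp_sum2_swap q01 sM')//; exact: bidisc_swap.
- by move=> w' z' /bidisc_swap zw'; rewrite cF// (dp_sum2_swap q01 cM).
- exact: bidisc_swap.
Qed.

Lemma dp_sum2_eq0_shift rz rw c k : 0 < rz -> 0 <= rw ->
  normal_cvg q rz rw c ->
  (forall z w, bidisc rz rw (z, w) -> dp_sum2 q c z w = 0) ->
  normal_cvg q rz rw (fun r s => c (k + r)%N s) /\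
  forall z w, bidisc rz rw (z, w) ->
    dp_sum2 q (fun r s => c (k + r)%N s) z w = 0.
Proof.
move=> rz0 rw0; elim: k c => [//|k IH] c cM c0.
have sM := normal_cvg_shift q01 rz0 rw0 cM.
have [] := IH (shift_z c) sM => [z w zw|sM' s0]; last by split.
have j0 := jackson_dp_expansion (F := fun _ _ => 0) q01 rz0 cM.
rewrite -(j0 z w)//; last by move=> z' w' zw'; rewrite c0.
have -> // : jackson q (fun=> 0 : X) z = 0.
  have jq0 : jackson_quot q (fun=> 0 : X) = fun=> 0.
    by apply/funext => h; rewrite /jackson_quot subrr scaler0.
  by rewrite /jackson jq0; case: ifP => // _; apply: lim_cst.
Qed.

(** Radius 0 in [w] is allowed: the bidisc degenerates to a disc and the double series to its column
    [s = 0]. This is the one-variable identity theorem, also applied to face data. *)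
Lemma dp_sum2_eq0_face rz c : 0 < rz -> normal_cvg q rz 0 c ->
  (forall z, rnorm z <= rz -> dp_sum2 q c z 0 = 0) -> forall r, c r 0%N = 0.
Proof.
move=> rz0 cM c0 r.
have [|_ s0] := dp_sum2_eq0_shift r rz0 (lexx 0) cM.
  move=> z w /bidiscE[zz w0]; have /eqP : rnorm w = 0.
    by apply/eqP; rewrite eq_le w0 rnorm_ge0.
  by rewrite rnorm_eq0 => /eqP ->; apply: c0.
rewrite -[r in c r]addn0 -(dp_sum2_00 (fun r' s => c (r + r')%N s)) s0//.
by apply/bidiscE; rewrite rnorm0 ltW.
Qed.

Lemma dp_sum2_eq0 rz rw c : 0 < rz -> 0 < rw -> normal_cvg q rz rw c ->
  (forall z w, bidisc rz rw (z, w) -> dp_sum2 q c z w = 0) ->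
  forall r s, c r s = 0.
Proof.
move=> rz0 rw0 cM c0 r s.
have [cM' s0] := dp_sum2_eq0_shift r rz0 (ltW rw0) cM c0.
have := normal_cvg_swap q01 (ltW rz0) (ltW rw0) cM'.
have w2 : 0 <= rw <= rw by rewrite lexx ltW.
have z2 : 0 <= (0 : R) <= rz by rewrite lexx ltW.
move=> /(normal_cvgW w2 z2) /(dp_sum2_eq0_face rw0) /(_ _ s) H.
(* After [r] derivatives in [z], the function is restricted to [z = 0] and the one-variable
   statement is applied in [w]. *)
rewrite -[r]addn0; apply: H => w ww.
have zw : bidisc rz rw (0, w) by apply/bidiscE; rewrite rnorm0 ltW.
by rewrite (dp_sum2_swap q01 cM' zw) s0.
Qed.

End UniquenessOfCoefficients.

(** * Operator norms of bounded maps *)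

Section OperatorNorm.
Context {R : realType} {X : completeNormedModType R[i]}.
Implicit Types (T U : {linear X -> X}).

(** [opnorm] is a real [sup], meaningful only for a nonempty bounded set; this is why a bound [M]
    accompanies each operator. As [M] has no prescribed sign, [|M|] serves as upper bound. *)
Lemma opnorm_has_sup (f : X -> X) (M : R) :
  f 0 = 0 -> (forall x, rnorm (f x) <= M * rnorm x) ->
  has_sup [set rnorm (f x) | x in [set x | rnorm x <= 1]].
Proof.
move=> f0 fM; split; first by exists 0, 0; rewrite /= ?f0 rnorm0.
exists `|M| => _ [x /= x1 <-]; apply: (le_trans (fM x)).
rewrite (le_trans (ler_wpM2r (rnorm_ge0 x) (ler_norm M)))//.
by rewrite ler_piMr.
Qed.

Lemma opnorm_ge0 (f : X -> X) (M : R) :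
  f 0 = 0 -> (forall x, rnorm (f x) <= M * rnorm x) -> 0 <= opnorm f.
Proof.
move=> f0 fM; apply: sup_upper_bound; first exact: opnorm_has_sup fM.
by exists 0; rewrite /= ?f0 rnorm0.
Qed.

Lemma ler_opnorm T (M : R) x : (forall x, rnorm (T x) <= M * rnorm x) ->
  rnorm (T x) <= opnorm T * rnorm x.
Proof.
move=> TM; have [->|x0] := eqVneq x 0.
  by rewrite linear0 !rnorm0 mulr0.
have nx : 0 < rnorm x by rewrite lt_neqAle eq_sym rnorm_eq0 x0 rnorm_ge0.
rewrite -ler_pdivrMr// mulrC.
have -> : (rnorm x)^-1 * rnorm (T x) = rnorm (T (((rnorm x)^-1)%:C *: x)).
  by rewrite linearZ rnormZ rnormr ger0_norm// invr_ge0 ltW.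
apply: sup_upper_bound; first exact: (opnorm_has_sup (linear0 T) TM).
eexists; last by reflexivity.
rewrite /= rnormZ rnormr ger0_norm ?invr_ge0 ?rnorm_ge0//.
by rewrite mulVf ?gt_eqF.
Qed.

End OperatorNorm.

(** * Series of nonnegative reals *)

Section NonnegativeSeries.
Context {R : realType}.
Implicit Types (u : nat -> R).

Lemma nneseries_leP u (M : R) : (forall k, 0 <= u k) ->
  (\sum_(0 <= k <oo) (u k)%:E <= M%:E)%E <->
  forall n, \sum_(k < n) u k <= M.
Proof.
move=> u0; split=> H.
  move=> n; rewrite -lee_fin (le_trans _ H)// -sumEFin -(big_mkord xpredT (fun k => (u k)%:E)).
  by apply: nneseries_lim_ge => k _; rewrite lee_fin.
apply: lime_le.
  by apply: is_cvg_nneseries => k _; rewrite lee_fin.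
by apply: nearW => n; rewrite big_mkord sumEFin lee_fin.
Qed.

Lemma fine_nneseries u : (forall k, 0 <= u k) ->
  (\sum_(0 <= k <oo) (u k)%:E < +oo)%E ->
  (\sum_(0 <= k <oo) (u k)%:E)%E = (fine (\sum_(0 <= k <oo) (u k)%:E)%E)%:E.
Proof.
move=> u0 uoo; rewrite fineK// ge0_fin_numE//.
by apply: nneseries_ge0 => k _; rewrite lee_fin.
Qed.

Lemma sum_geometric_le (x : R) n : 0 <= x < 1 -> \sum_(k < n) x ^+ k <= (1 - x)^-1.
Proof.
move=> /andP[x0 x1]; have d0 : 0 < 1 - x by rewrite subr_gt0.
rewrite -[leRHS]div1r ler_pdivlMr// mulrC -opprB mulNr -subrX1 opprB gerBl.
exact: exprn_ge0.
Qed.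

End NonnegativeSeries.

(** * Finiteness of [Phi] and the diagonal estimate *)

Section Bounds.
Context {R : realType}.
Variables (q : R) (q01 : 0 < q < 1).

(** Ratio test: successive terms have ratio [t / [k+1]_q^2], decreasing to [t (1-q)^2 < 1]. From a
    suitable index [K] on, the terms are dominated by a geometric series of ratio [th]. *)
Lemma Phi_lty (t : R) : 0 <= t < (1 - q) ^- 2 -> (Phi q t < +oo)%E.
Proof.
move=> /andP[t0 t1].
have [q0 q1] : 0 < q /\ q < 1 by apply/andP.
have d0 : 0 < 1 - q by rewrite subr_gt0.
pose f k := t ^+ k / qfact q k ^+ 2.
have f0 k : 0 <= f k by rewrite divr_ge0 ?exprn_ge0// ltW ?qfact_gt0.
have tau1 : t * (1 - q) ^+ 2 < 1 by rewrite -ltr_pdivlMr ?exprn_gt0// div1r.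
(* With [x = q^(K+1)], the inequality [(1 - x)^2 >= 1 - 2 x] turns this choice into
   [t (1-q)^2 < (1 - x)^2], that is [th < 1]. *)
have [K qK] : exists K, 2 * q ^+ K.+1 < 1 - t * (1 - q) ^+ 2.
  have h0 : 0 < (1 - t * (1 - q) ^+ 2) / 2 by rewrite divr_gt0// subr_gt0.
  have /cvgrPdist_lt/(_ _ h0) [K _ /(_ K.+1 (leqnSn K))] : q ^+ n @[n --> \oo] --> (0 : R).
    by apply: cvg_expr; rewrite gtr0_norm.
  rewrite /= sub0r normrN gtr0_norm ?exprn_gt0// ltr_pdivlMr// mulrC => ?.
  by exists K.
pose th := t / qnum q K.+1 ^+ 2.
have n0 := qnumS_gt0 K q01.
have th01 : 0 <= th < 1.
  rewrite divr_ge0 ?exprn_ge0 ?(ltW n0)//= ltr_pdivrMr ?exprn_gt0// mul1r.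
  rewrite /qnum expr_div_n ltr_pdivlMr ?exprn_gt0//.
  have := sqr_ge0 (q ^+ K.+1); nra.
have fK i : f (K + i)%N <= f K * th ^+ i.
  elim: i => [|i IH]; first by rewrite addn0 mulr1.
  rewrite addnS [in leRHS]exprSr mulrA.
  have -> : f (K + i).+1 = f (K + i)%N * (t / qnum q (K + i).+1 ^+ 2).
    by rewrite /f exprSr qfactS exprMn mulf_div.
  have ki0 := qnumS_gt0 (K + i) q01.
  rewrite ler_pM// ?divr_ge0 ?exprn_ge0 ?(ltW ki0)//.
  rewrite /th ler_wpM2l// lef_pV2 ?posrE ?exprn_gt0//.
  by rewrite lerXn2r ?nnegrE ?(ltW n0) ?(ltW ki0)// ler_qnum// ltnS leq_addr.
apply: (@le_lt_trans _ _ (\sum_(k < K) f k + f K * (1 - th)^-1)%:E); last exact: ltry.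
apply/nneseries_leP => // n.
apply: (@le_trans _ _ (\sum_(k < K + n) f k)).
  rewrite -!(big_mkord xpredT f) (big_cat_nat (n := n) (p := (K + n)%N))//= ?leq_addl//.
  by rewrite lerDl sumr_ge0.
rewrite big_split_ord /= lerD2l.
apply: (@le_trans _ _ (\sum_(i < n) f K * th ^+ i)); first exact: ler_sum.
by rewrite -mulr_sumr ler_wpM2l// sum_geometric_le.
Qed.

Context {X : completeNormedModType R[i]}.
Variables (rz rw : R) (rz0 : 0 < rz) (rw0 : 0 < rw).

(** [qfactD_ge] is applied once in each variable, whence the square of [[k]_q!]. *)
Lemma dp_weight_diag k r s :
  dp_weight q rz rw ((k + r)%N, (k + s)%N)
  <= (rz * rw) ^+ k / qfact q k ^+ 2 * dp_weight q rz rw (r, s).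
Proof.
rewrite /dp_weight /= !exprD mulrACA -exprMn mulf_div ler_wpM2l//.
  by rewrite !mulr_ge0 ?exprn_ge0 ?mulr_ge0// ltW.
rewrite lef_pV2 ?posrE ?mulr_gt0 ?exprn_gt0 ?qfact_gt0//.
rewrite expr2 mulrACA ler_pM ?mulr_ge0 ?qfactD_ge//.
all: by rewrite ltW ?qfact_gt0.
Qed.

(* Sum along the diagonals [s - r = const]: each step down a diagonal costs a
   factor [mu], and the weights are submultiplicative since
   [k]_q! [r]_q! <= [k + r]_q!. *)
Lemma diagonal_bound (c : nat -> nat -> X) (b : nat -> X) (mu L Ma Mb P : R) :
  0 <= mu -> 0 <= L ->
  (forall r s, rnorm (c r.+1 s.+1) <= mu * rnorm (c r s)) ->
  (forall r, rnorm (c r.+1 0%N) <= L * rnorm (b r)) ->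
  (forall n, \sum_(s < n) rw ^+ s / qfact q s * rnorm (c 0%N s) <= Ma) ->
  (forall n, \sum_(r < n) rz ^+ r / qfact q r * rnorm (b r) <= Mb) ->
  (forall n, \sum_(k < n) (mu * rz * rw) ^+ k / qfact q k ^+ 2 <= P) ->
  forall J : {fset nat * nat},
    \sum_(rs <- J) dp_weight q rz rw rs * rnorm (c rs.1 rs.2)
    <= P * (Ma + rz * L * Mb).
Proof.
move=> mu0 L0 c_mu cL aM bM PM J.
pose G r s := dp_weight q rz rw (r, s) * rnorm (c r s).
have G0 r s : 0 <= G r s.
  by rewrite mulr_ge0 ?rnorm_ge0 ?dp_weight_ge0// ltW.
pose f k := (mu * rz * rw) ^+ k / qfact q k ^+ 2.
have f0 k : 0 <= f k.
  by rewrite divr_ge0 ?exprn_ge0 ?mulr_ge0// ltW ?qfact_gt0.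
have c_diag k r s : rnorm (c (k + r)%N (k + s)%N) <= mu ^+ k * rnorm (c r s).
  elim: k => [|k IH]; first by rewrite mul1r.
  by rewrite !addSn exprS -mulrA (le_trans (c_mu _ _))// ler_wpM2l.
have G_diag k r s : G (k + r)%N (k + s)%N <= f k * G r s.
  have -> : f k = mu ^+ k * (rz * rw) ^+ k / qfact q k ^+ 2.
    by rewrite /f -(mulrA mu) exprMn.
  rewrite /G; have -> : mu ^+ k * (rz * rw) ^+ k / qfact q k ^+ 2
      * (dp_weight q rz rw (r, s) * rnorm (c r s))
    = ((rz * rw) ^+ k / qfact q k ^+ 2 * dp_weight q rz rw (r, s))
      * (mu ^+ k * rnorm (c r s)) by ring.
  by rewrite ler_pM ?dp_weight_diag ?rnorm_ge0 ?dp_weight_ge0// ltW.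
set H := Ma + _.
(* The first row and first column of a square: the row is charged to [Ma], the column to
   [rz * L * Mb]. *)
have hook n : \sum_(s < n.+1) G 0%N s + \sum_(r < n) G r.+1 0%N <= H.
  apply: lerD.
    apply: le_trans (aM n.+1); apply: ler_sum => s _.
    by rewrite /G /dp_weight /= qfact0 !mul1r.
  (* The column starts at index [r+1] while [b] starts at [r]: one power of [rz] goes into the
     constant, and [[r]_q! <= [r+1]_q!] absorbs the rest. *)
  apply: le_trans (ler_wpM2l _ (bM n)); last by rewrite mulr_ge0// ltW.
  rewrite mulr_sumr; apply: ler_sum => r _.
  rewrite /G /dp_weight /= qfact0 !mulr1.
  apply: (@le_trans _ _ (rz ^+ r.+1 / qfact q r.+1 * (L * rnorm (b r)))).
    by rewrite ler_wpM2l ?cL// divr_ge0 ?exprn_ge0// ltW ?qfact_gt0.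
  rewrite exprS [leRHS](_ : _ = rz * rz ^+ r / qfact q r * (L * rnorm (b r))); last by ring.
  rewrite ler_wpM2r ?mulr_ge0 ?rnorm_ge0// ler_wpM2l ?mulr_ge0 ?exprn_ge0 ?(ltW rz0)//.
  rewrite lef_pV2 ?posrE ?qfact_gt0// qfactS ler_peMr ?qnumS_ge1//.
  by rewrite ltW ?qfact_gt0.
have H0 : 0 <= H by apply: le_trans (hook 0%N); rewrite addr_ge0 ?sumr_ge0.
(* Peeling the hook off the square with corner [(k, k)] leaves the smaller square with corner
   [(k+1, k+1)], and the hook at [(k, k)] is at most [f k] times the hook at the origin. *)
have square n k : \sum_(r < n) \sum_(s < n) G (k + r)%N (k + s)%N
    <= (\sum_(i < n) f (k + i)%N) * H.
  elim: n k => [|n IH] k; first by rewrite !big_ord0 mul0r.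
  rewrite [X in X * H]big_ord_recl mulrDl addn0.
  rewrite big_ord_recl /= addn0.
  under [X in _ + X]eq_bigr do rewrite big_ord_recl /=.
  rewrite big_split /= addrA lerD//.
    apply: le_trans (ler_wpM2l (f0 k) (hook n)); rewrite mulrDr !mulr_sumr.
    apply: lerD; apply: ler_sum => i _; first by rewrite -[k in G k]addn0.
    exact: G_diag.
  have -> : \sum_(i < n) f (k + lift ord0 i)%N = \sum_(i < n) f (k.+1 + i)%N.
    by apply: eq_bigr => i _; rewrite addSnnS.
  apply: le_trans (IH k.+1); rewrite le_eqVlt; apply/predU1P; left.
  by apply: eq_bigr => r _; apply: eq_bigr => s _; rewrite !addSnnS.
(* Any finite set of indices lies in a square at the origin. *)
have [n Jn] : exists n, forall rs, rs \in J -> (maxn rs.1 rs.2 < n)%N.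
  exists (\max_(rs <- J) maxn rs.1 rs.2).+1 => rs rsJ.
  by rewrite ltnS (big_rem rs)//= leq_maxl.
pose s := [seq (r, s) | r <- index_iota 0 n, s <- index_iota 0 n].
apply: (@le_trans _ _ (\sum_(rs <- s) G rs.1 rs.2)).
  rewrite (eq_bigr (fun rs => G rs.1 rs.2)); last by move=> [].
  apply: ler_sum_subset => [| |rs rsJ|[] //]; first exact: fset_uniq.
    by apply: allpairs_uniq; rewrite ?iota_uniq// => -[? ?] [? ?].
  have := Jn _ rsJ; rewrite gtn_max => /andP[r1 r2]; apply/allpairsP; exists rs.
  by rewrite !mem_index_iota; split=> //; case: (rs).
rewrite /s big_allpairs big_mkord; under eq_bigr do rewrite big_mkord.
by apply: (le_trans (square n 0%N)); rewrite ler_wpM2r//; exact: PM.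
Qed.

End Bounds.

(* Unfolding [mjackson] makes failing conversion tests diverge. *)
#[local] Opaque mjackson.

(** * Jackson derivatives of polynomials: coefficients and norm *)

Section JacksonCoefficients.
Context {R : realType} {n : nat}.
Variables (q : R) (q01 : 0 < q < 1).
Implicit Types (i : 'I_n) (p : mpoly n R[i]).

Let q_neq1 : q != 1.
Proof. by case/andP: q01 => _ ?; rewrite lt_eqF. Qed.

Lemma mcoeff_mdilate i p m :
  mcoeff m (mdilate q i p) = (q ^+ m i)%:C * mcoeff m p.
Proof.
rewrite [in RHS](mpolyE p) [in LHS](mpolyE p).
rewrite (big_morph (mdilate q i) (comp_mpolyD _) (comp_mpoly0 _)).
rewrite !(big_morph _ (mcoeffD m) (mcoeff0 _ m)) mulr_sumr.
apply: eq_bigr => g _; rewrite /mdilate comp_mpolyZ -/(mdilate q i _) mdilateX.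
rewrite !mcoeffZ mcoeffX; case: (g =P m) => [->|_]; last by rewrite !mulr0.
by rewrite rmorphXn mulrCA.
Qed.

(** Obtained by comparing coefficients in the identity characterising the [xget] choice; linearity,
    commutation and boundedness all follow from this formula. *)
Lemma mcoeff_mjackson i p g :
  mcoeff g (mjackson q i p)
  = (qnum q (g i).+1)%:C * mcoeff (mnm_add g (mnm1 i)) p.
Proof.
have := congr1 (mcoeff (mnm_add (mnm1 i) g)) (mjacksonP i p q_neq1).
rewrite mulrC -scalerAr mcoeffZ mcoeffMX mcoeffB mcoeff_mdilate addmC.
rewrite mnmDE mnm1E eqxx addn1 -[X in _ = _ - X]mul1r -mulrBl => H.
have q1 : (q - 1)%:C != 0 :> R[i].
  by rewrite eq_complex /= eqxx andbT subr_eq0.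
apply: (mulfI q1); rewrite H mulrA; congr (_ * _).
rewrite -(rmorph1 (real_complex R)) -rmorphB -rmorphM; congr (_%:C).
by rewrite /qnum; field; rewrite subr_eq0 eq_sym.
Qed.

Lemma mjackson_linear i c p p' :
  mjackson q i (c *: p + p') = c *: mjackson q i p + mjackson q i p'.
Proof.
apply/mpolyP => g; rewrite mcoeffD mcoeffZ !mcoeff_mjackson mcoeffD mcoeffZ.
by rewrite mulrDr mulrCA.
Qed.

Lemma mjacksonC i k p : mjackson q i (mjackson q k p) = mjackson q k (mjackson q i p).
Proof.
have [->//|ik] := eqVneq i k; apply/mpolyP => g.
have E i' k' : i' != k' -> mcoeff g (mjackson q i' (mjackson q k' p))
    = (qnum q (g i').+1)%:C * ((qnum q (g k').+1)%:C
      * mcoeff (mnm_add g (mnm_add (mnm1 i') (mnm1 k'))) p).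
  move=> ik'; rewrite mcoeff_mjackson mcoeff_mjackson mnmDE mnm1E (negPf ik') addn0.
  by rewrite addmA.
by rewrite [LHS]E// [RHS]E 1?eq_sym// mulrCA (addmC (mnm1 i)).
Qed.

Lemma qfact_prod_ge0 (g : multinom n) : 0 <= \prod_(k < n) qfact q (g k).
Proof. by apply: prodr_ge0 => k _; exact/ltW/qfact_gt0. Qed.

Definition poly_norm2 p : R :=
  \sum_(g <- msupp p) rnorm (mcoeff g p) ^+ 2 * \prod_(k < n) qfact q (g k).

Lemma poly_norm2_ge0 p : 0 <= poly_norm2 p.
Proof.
apply: sumr_ge0 => g _; apply: mulr_ge0; first exact: sqr_ge0.
exact: qfact_prod_ge0.
Qed.

Lemma poly_norm2_sign k p : poly_norm2 ((-1) ^+ k *: p) = poly_norm2 p.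
Proof.
rewrite /poly_norm2 (perm_big _ (msuppZ _ _)); last by rewrite signr_eq0.
apply: eq_bigr => g _; rewrite mcoeffZ rnormM rnormX rnormN.
by rewrite [rnorm 1](rnormr 1) normr1 expr1n mul1r.
Qed.

(** The squared coefficient gains [[g_i+1]_q^2] while the weight loses one factor [[g_i+1]_q]; the
    net factor [[g_i+1]_q] is at most [1/(1-q)]. Distinct monomials of the derivative come from
    distinct monomials of [p]. *)
Lemma poly_norm2_mjackson i p :
  poly_norm2 (mjackson q i p) <= (1 - q)^-1 * poly_norm2 p.
Proof.
pose F g := rnorm (mcoeff g p) ^+ 2 * \prod_(k < n) qfact q (g k).
have F0 g : 0 <= F g.
  by apply: mulr_ge0; [exact: sqr_ge0|exact: qfact_prod_ge0].
have inj : injective (fun g : multinom n => mnm_add g (mnm1 i)) by exact: addIm.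
pose s := [seq mnm_add g (mnm1 i) | g <- msupp (mjackson q i p)].
have q1 : 0 <= (1 - q)^-1.
  by case/andP: q01 => _ ?; rewrite invr_ge0 subr_ge0 ltW.
apply: (@le_trans _ _ ((1 - q)^-1 * \sum_(h <- s) F h)); last first.
  rewrite ler_wpM2l//; apply: ler_sum_subset => //.
    by rewrite map_inj_uniq// msupp_uniq.
  move=> _ /mapP[g + ->]; rewrite !mcoeff_msupp mcoeff_mjackson.
  by rewrite mulf_eq0 negb_or => /andP[].
rewrite /s big_map mulr_sumr; apply: ler_sum => g _; rewrite /F.
have -> : \prod_(k < n) qfact q (mnm_add g (mnm1 i) k)
    = qnum q (g i).+1 * \prod_(k < n) qfact q (g k).
  rewrite (bigD1 i)//= [in RHS](bigD1 i)//= mnmDE mnm1E eqxx addn1 qfactS.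
  rewrite -mulrA [RHS]mulrCA; congr (_ * (_ * _)); apply: eq_bigr => k ki.
  by rewrite mnmDE mnm1E eq_sym (negPf ki) addn0.
rewrite mcoeff_mjackson rnormM rnormr ger0_norm ?qnum_ge0// exprMn.
set a := rnorm _; set N := qnum _ _; set P := \prod_(_ < _) _.
have aP : 0 <= a ^+ 2 * (N * P).
  apply: mulr_ge0; first exact: sqr_ge0.
  by apply: mulr_ge0; [exact: qnum_ge0|exact: qfact_prod_ge0].
rewrite [leLHS](_ : _ = N * (a ^+ 2 * (N * P))); last by ring.
by rewrite ler_wpM2r// qnum_le.
Qed.

End JacksonCoefficients.

(** * Anticommutation of exterior products and of contractions *)

Section ExteriorSigns.
Context {n : nat} {K : comPzRingType} {V : lmodType K}.
Implicit Types (i k : 'I_n) (S : {set 'I_n}) (u v : {ffun {set 'I_n} -> V}).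

Lemma ext_signU1 i k S : i \notin S ->
  ext_sign k (i |: S)%SET = (ext_sign k S + (i < k))%N.
Proof.
move=> iS; rewrite /ext_sign (cardD1 i) addnC; congr (_ + _)%N.
  by apply: eq_card => l; rewrite !inE; case: eqVneq => [->|//]; rewrite (negPf iS).
by rewrite !inE eqxx.
Qed.

Lemma ext_signD1 i k S : i \in S ->
  ext_sign k S = (ext_sign k (S :\ i)%SET + (i < k))%N.
Proof.
by move=> iS; rewrite -{1}(finset.setD1K iS) ext_signU1// !inE eqxx.
Qed.

(** Exactly one of [k < i] and [i < k] holds, so the two orders differ by one sign; both
    anticommutation rules reduce to this. *)
Let sign_swap i k a b (v : V) : i != k ->
  (-1) ^+ (a + (k < i)) *: ((-1) ^+ b *: v)
  = - ((-1) ^+ (b + (i < k)) *: ((-1) ^+ a *: v)) :> V.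
Proof.
rewrite -val_eqE /= !scalerA -!exprD -scaleNr => ik; congr (_ *: _).
case: (ltngtP i k) ik => //= _ _; rewrite ?addn0 ?addn1.
  by rewrite addSn exprS mulN1r opprK addnC.
by rewrite addSn exprS mulN1r addnC.
Qed.

Lemma ext_mul_anti i k u : ext_mul i (ext_mul k u) = - ext_mul k (ext_mul i u).
Proof.
apply/ffunP => S; rewrite !ffunE !inE eq_sym.
have [->|ik] := eqVneq i k; first by rewrite /= scaler0 if_same oppr0.
rewrite /=; case: (boolP (i \in S)) => iS; last first.
  by rewrite scaler0 if_same oppr0.
case: (boolP (k \in S)) => kS; last by rewrite scaler0 oppr0.
rewrite (ext_signD1 i kS) (ext_signD1 k iS) !finset.setDDl finset.setUC.
exact: sign_swap.
Qed.

Lemma ext_contr_anti i k u :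
  ext_contr i (ext_contr k u) = - ext_contr k (ext_contr i u).
Proof.
apply/ffunP => S; rewrite !ffunE !inE eq_sym.
have [->|ik] := eqVneq i k; first by rewrite /= scaler0 if_same oppr0.
rewrite /=; case: (boolP (i \in S)) => iS; first by rewrite scaler0 if_same oppr0.
case: (boolP (k \in S)) => kS; first by rewrite scaler0 oppr0.
rewrite (ext_signU1 k iS) (ext_signU1 i kS) !finset.setUA (finset.setUC [set k]%SET).
have sC c d (w : V) : c *: (d *: w) = d *: (c *: w) by rewrite !scalerA mulrC.
by rewrite sC [in RHS]sC; apply: sign_swap; rewrite eq_sym.
Qed.

Lemma ext_mul_linear i c u v :
  ext_mul i (c *: u + v) = c *: ext_mul i u + ext_mul i v.
Proof.
apply/ffunP => S; rewrite !ffunE.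
case: ifP => _; last by rewrite scaler0 addr0.
by rewrite scalerDr !scalerA mulrC.
Qed.

Lemma ext_contr_linear i c u v :
  ext_contr i (c *: u + v) = c *: ext_contr i u + ext_contr i v.
Proof.
apply/ffunP => S; rewrite !ffunE.
case: ifP => _; first by rewrite scaler0 addr0.
by rewrite scalerDr !scalerA mulrC.
Qed.

End ExteriorSigns.

(** * Norm bounds and commutation rules on polynomial forms *)

Section FormOperators.
Context {R : realType} {n : nat}.
Variables (q : R) (q01 : 0 < q < 1).
Implicit Types (p : poly_form R n) (k : 'I_(n + n)) (i : 'I_n).

Lemma form_norm2_ge0 p : 0 <= form_norm2 q p.
Proof. by apply: sumr_ge0 => S _; exact: poly_norm2_ge0. Qed.

Lemma form_norm2_jackson k p :
  form_norm2 q (form_jackson q k p) <= (1 - q)^-1 * form_norm2 q p.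
Proof.
rewrite /form_norm2 mulr_sumr; apply: ler_sum => S _.
by rewrite ffunE; exact: poly_norm2_mjackson.
Qed.

Let poly_norm2_0 : poly_norm2 q (0 : mpoly (n + n) R[i]) = 0.
Proof. by rewrite /poly_norm2 msupp0 big_nil. Qed.

(** Removing [i] is a bijection from sets containing [i] to sets avoiding it, so up to sign the
    product retains just the components of [p] on the latter. *)
Lemma form_norm2_ext_mul i p : form_norm2 q (ext_mul i p) <= form_norm2 q p.
Proof.
have -> : form_norm2 q (ext_mul i p)
    = \sum_(S : {set 'I_n} | i \in S) poly_norm2 q (p (S :\ i)%SET).
  rewrite [RHS]big_mkcond; apply: eq_bigr => S _.
  rewrite -/(poly_norm2 q _) ffunE; case: ifP => _ //.
  exact: poly_norm2_sign.
rewrite (reindex_onto (fun S => i |: S)%SET (fun S => S :\ i)%SET); last first.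
  by move=> S iS; rewrite finset.setD1K.
rewrite (eq_bigl (fun S : {set 'I_n} => i \notin S)).
  rewrite /form_norm2 [leRHS](bigID (fun S : {set 'I_n} => i \notin S))/=.
  rewrite -[leLHS]addr0 lerD ?sumr_ge0//; last by move=> S _; exact: poly_norm2_ge0.
  by rewrite le_eqVlt; apply/predU1P; left; apply: eq_bigr => S iS; rewrite finset.setU1K.
move=> S; rewrite finset.setU11/=; apply/eqP/idP => [<-|iS].
  by rewrite !inE eqxx.
by rewrite finset.setU1K.
Qed.

Lemma form_norm2_ext_contr i p : form_norm2 q (ext_contr i p) <= form_norm2 q p.
Proof.
have -> : form_norm2 q (ext_contr i p)
    = \sum_(S : {set 'I_n} | i \notin S) poly_norm2 q (p (i |: S)%SET).
  rewrite [RHS]big_mkcond; apply: eq_bigr => S _.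
  rewrite -/(poly_norm2 q _) ffunE; case: ifP => _ //.
  exact: poly_norm2_sign.
rewrite (reindex_onto (fun S => S :\ i)%SET (fun S => i |: S)%SET); last first.
  by move=> S iS; rewrite finset.setU1K.
rewrite (eq_bigl (fun S : {set 'I_n} => i \in S)).
  rewrite /form_norm2 [leRHS](bigID (fun S : {set 'I_n} => i \in S))/=.
  rewrite -[leLHS]addr0 lerD ?sumr_ge0//; last by move=> S _; exact: poly_norm2_ge0.
  by rewrite le_eqVlt; apply/predU1P; left; apply: eq_bigr => S iS; rewrite finset.setD1K.
move=> S; rewrite !inE eqxx /=; apply/eqP/idP => [<-|iS].
  by rewrite !inE eqxx.
by rewrite finset.setD1K.
Qed.

Lemma form_jackson_linear k c p p' :
  form_jackson q k (c *: p + p') = c *: form_jackson q k p + form_jackson q k p'.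
Proof. by apply/ffunP => S; rewrite !ffunE mjackson_linear. Qed.

Lemma form_jacksonC k l p :
  form_jackson q k (form_jackson q l p) = form_jackson q l (form_jackson q k p).
Proof.
apply/ffunP => S; have E k' l' : form_jackson q k' (form_jackson q l' p) S
    = mjackson q k' (mjackson q l' (p S)).
  by rewrite ffunE; congr (mjackson _ _ _); rewrite ffunE.
by rewrite [LHS]E [RHS]E; exact: mjacksonC.
Qed.

Lemma mjackson0 k : mjackson q k (0 : mpoly (n + n) R[i]) = 0.
Proof. by apply/mpolyP => g; rewrite mcoeff_mjackson// !mcoeff0 mulr0. Qed.

Lemma mjacksonZ k c (p : mpoly (n + n) R[i]) :
  mjackson q k (c *: p) = c *: mjackson q k p.
Proof. by rewrite -[c *: p]addr0 mjackson_linear// mjackson0 addr0. Qed.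

Lemma form_jackson_ext_mul k i p :
  form_jackson q k (ext_mul i p) = ext_mul i (form_jackson q k p).
Proof.
apply/ffunP => S; rewrite !ffunE; case: ifP => _; last exact: mjackson0.
exact: mjacksonZ.
Qed.

Lemma form_jackson_ext_contr k i p :
  form_jackson q k (ext_contr i p) = ext_contr i (form_jackson q k p).
Proof.
apply/ffunP => S; rewrite !ffunE; case: ifP => _; first exact: mjackson0.
exact: mjacksonZ.
Qed.

End FormOperators.

(** * Dirac-type sums, treating both tangential operators at once *)

Section FormDirac.
Context {R : realType} {n : nat}.
Variables (q : R) (q01 : 0 < q < 1).
Variables (E : 'I_n -> poly_form R n -> poly_form R n) (h : 'I_n -> 'I_(n + n)).
Hypothesis E_linear : forall i c p p', E i (c *: p + p') = c *: E i p + E i p'.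
Hypothesis E_anti : forall i k p, E i (E k p) = - E k (E i p).
Hypothesis E_jackson :
  forall i k p, form_jackson q k (E i p) = E i (form_jackson q k p).
Hypothesis E_norm2 : forall i p, form_norm2 q (E i p) <= form_norm2 q p.

Let D (p : poly_form R n) : poly_form R n := \sum_(i < n) E i (form_jackson q (h i) p).

Lemma dirac_linear c p p' : D (c *: p + p') = c *: D p + D p'.
Proof.
rewrite /D scaler_sumr -big_split /=; apply: eq_bigr => i _.
by rewrite form_jackson_linear// E_linear.
Qed.

Let lin_sum (f : poly_form R n -> poly_form R n) (F : 'I_n -> poly_form R n) :
  (forall c p p', f (c *: p + p') = c *: f p + f p') ->
  f (\sum_i F i) = \sum_i f (F i).
Proof.
move=> fL; have f0 : f 0 = 0.
  by have := fL (-1) 0 0; rewrite scaler0 addr0 scaleN1r addNr.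
apply: (big_morph f) => // p p'.
by rewrite -[p in LHS]scale1r fL scale1r.
Qed.

(** In the double sum, exchanging the indices changes the sign through [E] and leaves the commuting
    derivatives alone, so the square equals its own opposite. *)
Lemma dirac_sqr p : D (D p) = 0.
Proof.
pose W i k := E i (E k (form_jackson q (h i) (form_jackson q (h k) p))).
have DDW : D (D p) = \sum_i \sum_k W i k.
  apply: eq_bigr => i _; rewrite /D (lin_sum _ (form_jackson_linear q01 (h i))).
  rewrite (lin_sum _ (E_linear i)); apply: eq_bigr => k _.
  by rewrite /W E_jackson.
have : D (D p) = - D (D p).
  rewrite {1}DDW exchange_big DDW -sumrN; apply: eq_bigr => i _.
  rewrite -sumrN; apply: eq_bigr => k _.
  by rewrite /W E_anti form_jacksonC.
move=> /eqP; rewrite -addr_eq0 -mulr2n -scaler_nat scaler_eq0.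
by rewrite pnatr_eq0 => /eqP.
Qed.

Lemma dirac_bounded (X : completeNormedModType R[i])
    (j : {linear poly_form R n -> X}) :
  (forall p, rnorm (j p) = Num.sqrt (form_norm2 q p)) ->
  exists2 C : R, 0 <= C & forall p, rnorm (j (D p)) <= C * rnorm (j p).
Proof.
(* There are [n] summands, each of norm at most the square root of the bound for one Jackson
   derivative. *)
move=> jN; exists (n%:R * Num.sqrt ((1 - q)^-1)) => [|p].
  by rewrite mulr_ge0 ?sqrtr_ge0.
rewrite linear_sum (le_trans (ler_rnorm_sum _ _ _))//.
have q1 : 0 <= (1 - q)^-1.
  by case/andP: q01 => _ ?; rewrite invr_ge0 subr_ge0 ltW.
apply: (@le_trans _ _ (\sum_(i < n) Num.sqrt ((1 - q)^-1) * rnorm (j p))).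
  apply: ler_sum => i _; rewrite !jN -sqrtrM// ler_sqrt.
    by rewrite (le_trans (E_norm2 _ _))// form_norm2_jackson.
  by rewrite mulr_ge0 ?form_norm2_ge0.
by rewrite sumr_const card_ord -[leLHS]mulr_natl mulrA.
Qed.

End FormDirac.

(** * Extension of bounded operators by density *)

Section BoundedExtension.
Context {R : realType} {n : nat} {X : completeNormedModType R[i]}.
Variables (j : {linear poly_form R n -> X}).
Hypothesis j_dense : dense (range j).

Lemma dense_approx (x : X) (e : R) : 0 < e -> exists p, rnorm (x - j p) < e.
Proof.
move=> e0; have e0C : 0 < e%:C :> R[i] by rewrite ltcR.
have ne : (ball x e%:C)° !=set0 by exists x; exact: (nbhsx_ballx x _ e0C).
have [y [/interior_subset + [p _ jp]]] := j_dense ne (open_interior _).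
by rewrite -ball_normE /= normr_rnorm ltcR -jp => ?; exists p.
Qed.

Variables (T0 : poly_form R n -> poly_form R n) (C : R).
Hypothesis C0 : 0 <= C.
Hypothesis T0_linear : forall c p p', T0 (c *: p + p') = c *: T0 p + T0 p'.
Hypothesis T0_bound : forall p, rnorm (j (T0 p)) <= C * rnorm (j p).

Let T0B p p' : T0 p - T0 p' = T0 (p - p').
Proof. by rewrite addrC -scaleN1r -T0_linear scaleN1r addrC. Qed.

Let T00 : T0 0 = 0.
Proof. by have := T0B 0 0; rewrite !subrr. Qed.

(* The estimate against every [p] determines [y]; as it is stable under linear
   combinations, it yields linearity and boundedness of [x |-> y] at once. *)
Lemma extension_value (x : X) :
  exists y, forall p, rnorm (y - j (T0 p)) <= C * rnorm (x - j p).
Proof.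
have /choice [p px] : forall k : nat, exists p, rnorm (x - j p) < k.+1%:R^-1.
  by move=> k; apply: dense_approx; rewrite invr_gt0.
pose v k := j (T0 (p k)).
(* One estimate does two jobs: with [p' = p N] it makes [v] Cauchy, and in the limit it becomes the
   required inequality. *)
have vv k (p' : poly_form R n) : rnorm (v k - j (T0 p')) <= C * (k.+1%:R^-1 + rnorm (x - j p')).
  rewrite /v -linearB T0B (le_trans (T0_bound _))// ler_wpM2l// linearB.
  have -> : j (p k) - j p' = - (x - j (p k)) + (x - j p') by rewrite opprB addrA subrK.
  by rewrite (le_trans (ler_rnormD _ _))// rnormN lerD2r ltW.
have small (e : R) : 0 < e -> \forall k \near \oo, C * k.+1%:R^-1 < e.
  move=> e0; have eC : 0 < e / (C + 1) by rewrite divr_gt0// ltr_wpDl.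
  have /cvgrPdist_lt/(_ _ eC) := @cvg_harmonic R.
  apply: filterS => k; rewrite /= sub0r normrN gtr0_norm ?invr_gt0//.
  rewrite ltr_pdivlMr ?ltr_wpDl// mulrC; apply: le_lt_trans.
  by rewrite ler_wpM2r ?invr_ge0// lerDl.
have : cvg (v k @[k --> \oo]).
  apply: cauchy_cvg; apply/cauchy_exP => e; case: e => er ei.
  rewrite ltcE /= => /andP[/eqP -> e0].
  have e2 : 0 < er / 2 by rewrite divr_gt0.
  have [N _ sN] := small _ e2; exists (v N); exists N => // k Nk.
  rewrite -ball_normE /= normr_rnorm ltcR (le_lt_trans (vv _ _))//.
  rewrite mulrDr (splitr er) ltr_leD ?sN//=.
  by apply: le_trans (ltW (sN k Nk)); rewrite ler_wpM2l// ltW.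
move=> /cvg_ex[y vy]; exists y => p'; apply/ler_addgt0Pr => e e0.
have vyp : v k - j (T0 p') @[k --> \oo] --> y - j (T0 p').
  by apply: cvgB; [exact: vy|exact: cvg_cst].
apply: (rnorm_cvg_le vyp).
near=> k; rewrite (le_trans (vv _ _))// mulrDr addrC lerD2l ltW//.
by near: k; exact: small.
Unshelve. all: by end_near.
Qed.

Lemma bounded_extension : exists T : {linear X -> X},
  (forall x, rnorm (T x) <= C * rnorm x) /\ forall p, T (j p) = j (T0 p).
Proof.
have /choice [T TP] := extension_value.
have Tlin : linear T.
  move=> c x y; apply: subr0_eq; apply: rnorm_lt_eq0 => e e0.
  (* With approximation error [e / N], the defect of linearity is at most [2 C (|c| + 1) e / N]; the
     final [+ 1] keeps [N] positive when [C = 0]. *)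
  pose N := C * 2 * (rnorm c + 1) + 1.
  have c1 : 0 < rnorm c + 1 by rewrite ltr_wpDl ?rnorm_ge0.
  have C2 : 0 <= C * 2 * (rnorm c + 1) by rewrite mulr_ge0 ?mulr_ge0// ltW.
  have N0 : 0 < N by rewrite ltr_wpDl.
  have eN : 0 < e / N by rewrite divr_gt0.
  have [p xp] := dense_approx x eN; have [p' yp'] := dense_approx y eN.
  (* By linearity of [T0] and [j] the inserted terms cancel, leaving three differences, each
     controlled by the defining estimate. *)
  have T3 : T (c *: x + y) - (c *: T x + T y)
      = (T (c *: x + y) - j (T0 (c *: p + p')))
        - (c *: (T x - j (T0 p)) + (T y - j (T0 p'))).
    rewrite T0_linear (linearP j) scalerBr; set s := T _; set t := c *: T x.
    set u := c *: j _; set v := j _; set t' := T y.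
    have -> : t - u + (t' - v) = (t + t') - (u + v) by rewrite addrACA opprD.
    by rewrite opprB [RHS]addrA subrK.
  rewrite T3 (le_trans (ler_rnormB _ _))//.
  have b1 : rnorm (c *: x + y - j (c *: p + p')) <= (rnorm c + 1) * (e / N).
    rewrite linearP opprD addrACA -scalerBr (le_trans (ler_rnormD _ _))//.
    by rewrite rnormZ mulrDl mul1r lerD// ?ler_wpM2l ?rnorm_ge0// ltW.
  have b2 : rnorm (c *: (T x - j (T0 p)) + (T y - j (T0 p')))
      <= C * ((rnorm c + 1) * (e / N)).
    rewrite (le_trans (ler_rnormD _ _))// rnormZ mulrDl mul1r mulrDr mulrCA.
    apply: lerD; last by rewrite (le_trans (TP _ _))// ler_wpM2l// ltW//.
    by rewrite ler_wpM2l ?rnorm_ge0// (le_trans (TP _ _))// ler_wpM2l// ltW.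
  apply: (le_trans (lerD (TP _ _) b2)).
  apply: (@le_trans _ _ (C * 2 * (rnorm c + 1) * (e / N))).
    rewrite [leRHS](_ : _ = C * ((rnorm c + 1) * (e / N)) + C * ((rnorm c + 1) * (e / N))); last by ring.
    by rewrite lerD2r ler_wpM2l.
  rewrite mulrA ler_pdivrMr// mulrC ler_wpM2l ?(ltW e0)//.
  by rewrite lerDl.
pose TL : {linear X -> X} := HB.pack T (GRing.isLinear.Build _ _ _ _ T Tlin).
exists TL; split=> [x|p]; first by have := TP x 0; rewrite linear0 subr0 T00 linear0 subr0.
apply: subr0_eq; apply/eqP; rewrite -rnorm_eq0 eq_le rnorm_ge0 andbT.
by have := TP (j p) p; rewrite subrr rnorm0 mulr0.
Qed.

End BoundedExtension.

(** * The tangential operators on the completion *)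

Section TangentialOperators.
Context {R : realType} {n : nat} {X : completeNormedModType R[i]}.
Variables (q : R) (j : {linear poly_form R n -> X}).
Hypothesis q01 : 0 < q < 1.
Hypothesis jX : is_completion q j.

(** Existence of one extension gives [get] its specification. The chosen extension carries some
    bound [M], and squares to zero by density: [E (E x) = E (E (x - j p))] for every form [p]. *)
Lemma bounded_extP (T0 : poly_form R n -> poly_form R n) :
  (exists2 C : R, 0 <= C & forall p, rnorm (j (T0 p)) <= C * rnorm (j p)) ->
  (forall c p p', T0 (c *: p + p') = c *: T0 p + T0 p') ->
  (forall p, T0 (T0 p) = 0) ->
  exists (T : {linear X -> X}) (M : R),
    [/\ bounded_ext j T0 = T, forall x, rnorm (T x) <= M * rnorm x
      & forall x, T (T x) = 0].
Proof.
move=> [C C0 T0C] T0lin T02; have [_ jd] := jX.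
have [T [TC Tj]] := bounded_extension jd C0 T0lin T0C.
have [] : [set T | [/\ linear T, bounded_op T & forall p, T (j p) = j (T0 p)]]
    (bounded_ext j T0).
  apply: (@getPex _ [set T | [/\ linear T, bounded_op T & forall p, T (j p) = j (T0 p)]]).
  by exists (T : X -> X); split=> //; [exact: linearP|exists C].
move=> Elin [M EM] Ej.
pose E : {linear X -> X} :=
  HB.pack (bounded_ext j T0) (GRing.isLinear.Build _ _ _ _ (bounded_ext j T0) Elin).
exists E, M; split=> // x; apply: rnorm_lt_eq0 => e e0.
have M1 : 0 < `|M| + 1 by rewrite ltr_wpDl.
have [p xp] := dense_approx jd x (divr_gt0 e0 (mulr_gt0 M1 M1)).
have EM1 y : rnorm (E y) <= (`|M| + 1) * rnorm y.
  rewrite (le_trans (EM y))// ler_wpM2r ?rnorm_ge0//.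
  by rewrite (le_trans (ler_norm M))// lerDl.
have -> : E (E x) = E (E (x - j p)).
  by rewrite !linearB; rewrite [E (j p)]Ej [E (j (T0 p))]Ej T02 linear0 subr0.
rewrite (le_trans (EM1 _))// (le_trans (ler_wpM2l (ltW M1) (EM1 _)))//.
by rewrite mulrA mulrC -ler_pdivlMr ?mulr_gt0// ltW.
Qed.

Lemma opDP : exists (T : {linear X -> X}) (M : R),
  [/\ opD q j = T, forall x, rnorm (T x) <= M * rnorm x & forall x, T (T x) = 0].
Proof.
apply: bounded_extP.
- apply: (dirac_bounded q01 (E := ext_mul)); last by case: jX.
  exact: form_norm2_ext_mul.
- by apply: (dirac_linear q01 (E := ext_mul)) => i c p p'; exact: ext_mul_linear.
- apply: (dirac_sqr q01 (E := ext_mul)).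
  + by move=> i c p p'; exact: ext_mul_linear.
  + by move=> i k p; exact: ext_mul_anti.
  + by move=> i k p; exact: form_jackson_ext_mul.
Qed.

Lemma opDdP : exists (T : {linear X -> X}) (M : R),
  [/\ opDd q j = T, forall x, rnorm (T x) <= M * rnorm x & forall x, T (T x) = 0].
Proof.
apply: bounded_extP.
- apply: (dirac_bounded q01 (E := ext_contr)); last by case: jX.
  exact: form_norm2_ext_contr.
- by apply: (dirac_linear q01 (E := ext_contr)) => i c p p'; exact: ext_contr_linear.
- apply: (dirac_sqr q01 (E := ext_contr)).
  + by move=> i c p p'; exact: ext_contr_linear.
  + by move=> i k p; exact: ext_contr_anti.
  + by move=> i k p; exact: form_jackson_ext_contr.
Qed.

End TangentialOperators.

(** * The two-face problem for an abstract pair of operators *)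

Section TwoFaceProblem.
Context {R : realType} {X : completeNormedModType R[i]}.
Variables (q : R) (q01 : 0 < q < 1).
Variables (S U : {linear X -> X}) (MS MU : R).
Hypothesis S_bound : forall x, rnorm (S x) <= MS * rnorm x.
Hypothesis U_bound : forall x, rnorm (U x) <= MU * rnorm x.
Hypothesis S_sqr : forall x, S (S x) = 0.
Hypothesis U_sqr : forall x, U (U x) = 0.
Implicit Types (a b : nat -> X) (cA cB : nat -> nat -> X).

(** Symmetric under exchanging the indices together with [a] and [b], [S] and [U], [cA] and [cB]. *)
Definition two_face_coef a b cA cB : Prop :=
  [/\ forall s, cA 0%N s = a s, forall r, cB r 0%N = b r,
      forall r s, cA r.+1 s = S (cB r s) & forall r s, cB r s.+1 = U (cA r s)].

(** Linearity of the recursion in its data: continuous dependence thereby reduces to the norm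
    estimate for the difference of the data. *)
Lemma two_face_coefB a b cA cB a' b' cA' cB' :
  two_face_coef a b cA cB -> two_face_coef a' b' cA' cB' ->
  two_face_coef (fun s => a' s - a s) (fun r => b' r - b r)
    (fun r s => cA' r s - cA r s) (fun r s => cB' r s - cB r s).
Proof.
move=> [A0 B0 AS BS] [A0' B0' AS' BS']; split=> [s|r|r s|r s].
- by rewrite A0 A0'.
- by rewrite B0 B0'.
- by rewrite AS AS' linearB.
- by rewrite BS BS' linearB.
Qed.

Variables (rz rw : R) (rz0 : 0 < rz) (rw0 : 0 < rw).

Section Bound.
Variables (mu LS LU Ma Mb P : R).
Hypothesis mu0 : 0 <= mu.
Hypothesis LS0 : 0 <= LS.
Hypothesis LU0 : 0 <= LU.
Hypothesis S_opnorm : forall x, rnorm (S x) <= LS * rnorm x.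
Hypothesis U_opnorm : forall x, rnorm (U x) <= LU * rnorm x.
Hypothesis SU_mu : forall x, rnorm (S (U x)) <= mu * rnorm x.
Hypothesis US_mu : forall x, rnorm (U (S x)) <= mu * rnorm x.
Hypothesis PM : forall n, \sum_(k < n) (mu * rz * rw) ^+ k / qfact q k ^+ 2 <= P.
Variables (a b : nat -> X) (cA cB : nat -> nat -> X).
Hypothesis aM : forall n, \sum_(s < n) rw ^+ s / qfact q s * rnorm (a s) <= Ma.
Hypothesis bM : forall n, \sum_(r < n) rz ^+ r / qfact q r * rnorm (b r) <= Mb.
Hypothesis AB : two_face_coef a b cA cB.

Lemma two_face_boundA (J : {fset nat * nat}) :
  \sum_(rs <- J) dp_weight q rz rw rs * rnorm (cA rs.1 rs.2)
  <= P * (Ma + rz * LS * Mb).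
Proof.
have [A0 B0 AS BS] := AB.
apply: (diagonal_bound q01 rz0 rw0 (b := b) mu0 LS0) => // [r s|r|n].
- by rewrite AS BS.
- by rewrite AS B0.
- by apply: le_trans (aM n); apply: ler_sum => s _; rewrite A0.
Qed.

(** The diagonal estimate applied to the transposed coefficients, where [a] supplies the column and
    [b] the row. *)
Lemma two_face_boundB (J : {fset nat * nat}) :
  \sum_(rs <- J) dp_weight q rz rw rs * rnorm (cB rs.1 rs.2)
  <= P * (Mb + rw * LU * Ma).
Proof.
have [A0 B0 AS BS] := AB.
have bound (K : {fset nat * nat}) : \sum_(rs <- K) dp_weight q rw rz rs
    * rnorm (swap_zw cB rs.1 rs.2) <= P * (Mb + rw * LU * Ma).
  apply: (diagonal_bound q01 rw0 rz0 (b := a) mu0 LU0) => // [s r|s|n|n].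
  - by rewrite /swap_zw BS AS.
  - by rewrite /swap_zw BS A0.
  - by apply: le_trans (bM n); apply: ler_sum => s _; rewrite /swap_zw B0.
  - by apply: le_trans (PM n); apply: ler_sum => k _; rewrite (mulrAC mu).
apply: le_trans (bound [fset (rs.2, rs.1) | rs in J]%fset).
rewrite big_imfset/=; last by move=> ? ? _ _; apply: swap_inj.
apply: ler_sum => rs _; rewrite /dp_weight /swap_zw /=.
by rewrite (mulrC (rz ^+ _)) (mulrC (qfact q rs.2)).
Qed.

Lemma two_face_normal_cvg : normal_cvg q rz rw cA /\ normal_cvg q rz rw cB.
Proof.
have [z0 w0] := (ltW rz0, ltW rw0).
by split; apply/normal_cvgP => //;
  [exists (P * (Ma + rz * LS * Mb)) => J; exact: two_face_boundA
  |exists (P * (Mb + rw * LU * Ma)) => J; exact: two_face_boundB].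
Qed.

Lemma two_face_estimate z w : bidisc rz rw (z, w) ->
  rnorm (dp_sum2 q cA z w) <= P * (Ma + rz * LS * Mb) /\
  rnorm (dp_sum2 q cB z w) <= P * (Mb + rw * LU * Ma).
Proof.
move=> zw; split; apply: (rnorm_dp_sum2 q01 _ zw) => J.
  exact: two_face_boundA.
exact: two_face_boundB.
Qed.

End Bound.

Variables (a b : nat -> X) (cA cB : nat -> nat -> X).
Hypothesis AB : two_face_coef a b cA cB.
Hypothesis cA_normal : normal_cvg q rz rw cA.
Hypothesis cB_normal : normal_cvg q rz rw cB.

Let bidiscP := @bidiscE R.

(** All coefficients are annihilated: those on the face by hypothesis, the others because they are
    values of an operator of square zero. *)
Lemma two_face_null z w : (forall s, S (a s) = 0) -> (forall r, U (b r) = 0) ->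
  bidisc rz rw (z, w) ->
  S (dp_sum2 q cA z w) = 0 /\ U (dp_sum2 q cB z w) = 0.
Proof.
move=> Sa Ub zw; have [A0 B0 AS BS] := AB; split.
  rewrite -(dp_sum2_linear q01 S_bound cA_normal zw).
  rewrite [X in dp_sum2 _ X](_ : _ = fun _ _ => 0) ?dp_sum2_0//.
  by apply/funext => -[|r]; apply/funext => s; rewrite ?A0 ?AS.
rewrite -(dp_sum2_linear q01 U_bound cB_normal zw).
rewrite [X in dp_sum2 _ X](_ : _ = fun _ _ => 0) ?dp_sum2_0//.
by apply/funext => r; apply/funext => -[|s]; rewrite ?B0 ?BS.
Qed.

Lemma two_face_jackson z w : bidisc rz rw (z, w) ->
  jackson q (dp_sum2 q cA ^~ w) z = S (dp_sum2 q cB z w) /\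
  jackson q (dp_sum2 q cB z) w = U (dp_sum2 q cA z w).
Proof.
move=> zw; have [A0 B0 AS BS] := AB; split.
  rewrite (jackson_dp_expansion q01 rz0 cA_normal)//.
  rewrite -(dp_sum2_linear q01 S_bound cB_normal zw); congr dp_sum2.
  by apply/funext => r; apply/funext => s; rewrite /shift_z AS.
rewrite (jackson_dp_expansion_w q01 rw0 cB_normal)//.
rewrite -(dp_sum2_linear q01 U_bound cA_normal zw); congr dp_sum2.
by apply/funext => r; apply/funext => s; rewrite BS.
Qed.

Lemma two_face_data_sum2 :
  two_face_data q rz rw a b (dp_sum2 q cA) (dp_sum2 q cB).
Proof.
have [A0 B0 _ _] := AB; split=> [w|z]; rewrite ler_rnormc => le.
  have zw : bidisc rz rw (0, w) by apply/bidiscP; rewrite rnorm0 (ltW rz0).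
  rewrite (dp_sum2_face q01 cA_normal zw); congr dp_sum1.
  by apply/funext => s.
have zw : bidisc rz rw (z, 0) by apply/bidiscP; rewrite rnorm0 (ltW rw0).
rewrite -(dp_sum2_swap q01 cB_normal zw).
have sB := normal_cvg_swap q01 (ltW rz0) (ltW rw0) cB_normal.
rewrite (dp_sum2_face q01 sB (bidisc_swap zw)); congr dp_sum1.
by apply/funext => r; rewrite /swap_zw B0.
Qed.

(* The coefficients of a second solution minus [cA], [cB] satisfy the same
   recursion with zero face data. *)
Lemma two_face_unique (A B : R[i] -> R[i] -> X) :
  dp_class q rz rw A -> dp_class q rz rw B ->
  (forall z w, bidisc rz rw (z, w) -> jackson q (A ^~ w) z = S (B z w)) ->
  (forall z w, bidisc rz rw (z, w) -> jackson q (B z) w = U (A z w)) ->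
  two_face_data q rz rw a b A B ->
  forall z w, bidisc rz rw (z, w) ->
    A z w = dp_sum2 q cA z w /\ B z w = dp_sum2 q cB z w.
Proof.
move=> [c /[dup] Ac [cM _]] [d /[dup] Bd [dM _]] jA jB [A0 B0].
have {}Ac := dp_expansionE q01 Ac; have {}Bd := dp_expansionE q01 Bd.
have [z0 w0] := (ltW rz0, ltW rw0).
have [A0' B0'] := two_face_data_sum2.
pose e r s := c r s - cA r s; pose f r s := d r s - cB r s.
have eM : normal_cvg q rz rw e by exact: normal_cvgB.
have fM : normal_cvg q rz rw f by exact: normal_cvgB.
have eE z w : bidisc rz rw (z, w) -> dp_sum2 q e z w = A z w - dp_sum2 q cA z w.
  by move=> zw; rewrite (dp_sum2B q01 cM cA_normal zw) Ac.
have fE z w : bidisc rz rw (z, w) -> dp_sum2 q f z w = B z w - dp_sum2 q cB z w.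
  by move=> zw; rewrite (dp_sum2B q01 dM cB_normal zw) Bd.
(* On the face [z = 0] both solutions have the same values, and the one-variable identity theorem
   turns this into equality of coefficients. *)
have e0 s : e 0%N s = 0.
  have /(normal_cvgW q01 (rz := rw) (rw := 0)) : normal_cvg q rw rz (swap_zw e).
    exact: normal_cvg_swap.
  rewrite !lexx w0 z0 => /(_ isT isT)/(dp_sum2_eq0_face q01 rw0); apply => w ww.
  have zw : bidisc rz rw (0, w) by apply/bidiscP; rewrite rnorm0.
  by rewrite (dp_sum2_swap q01 eM zw) eE// A0 ?A0' ?subrr// ler_rnormc.
have f0 r : f r 0%N = 0.
  have /(normal_cvgW q01 (rz := rz) (rw := 0)) := fM.
  rewrite !lexx w0 z0 => /(_ isT isT)/(dp_sum2_eq0_face q01 rz0); apply => z zz.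
  have zw : bidisc rz rw (z, 0) by apply/bidiscP; rewrite rnorm0.
  by rewrite fE// B0 ?B0' ?subrr// ler_rnormc.
(* The Jackson equations of both solutions say that the series with coefficients [shift_z e - S f]
   vanishes on the bidisc; the identity theorem extracts the recursion. *)
have eS r s : e r.+1 s = S (f r s).
  apply: subr0_eq.
  have seM := normal_cvg_shift q01 rz0 w0 eM.
  have SfM := normal_cvg_linear q01 z0 w0 S_bound fM.
  have := dp_sum2_eq0 q01 rz0 rw0 (normal_cvgB q01 z0 w0 seM SfM); apply => z w zw.
  rewrite (dp_sum2B q01 seM SfM zw) (dp_sum2_linear q01 S_bound fM zw) fE//.
  have -> : shift_z e = fun r s => shift_z c r s - shift_z cA r s by [].
  rewrite (dp_sum2B q01 _ _ zw); [|exact: normal_cvg_shift..].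
  rewrite -(jackson_dp_expansion q01 rz0 cM Ac zw) jA//.
  rewrite -(jackson_dp_expansion (F := dp_sum2 q cA) q01 rz0 cA_normal _ zw)//.
  by have [-> _] := two_face_jackson zw; rewrite linearB subrr.
have fS r s : f r s.+1 = U (e r s).
  apply: subr0_eq.
  have seM := normal_cvg_shift_w q01 z0 rw0 fM.
  have SfM := normal_cvg_linear q01 z0 w0 U_bound eM.
  have := dp_sum2_eq0 q01 rz0 rw0 (normal_cvgB q01 z0 w0 seM SfM); apply => z w zw.
  rewrite (dp_sum2B q01 seM SfM zw) (dp_sum2_linear q01 U_bound eM zw) eE//.
  rewrite (dp_sum2B q01 _ _ zw); [|exact: normal_cvg_shift_w..].
  rewrite -(jackson_dp_expansion_w q01 rw0 dM Bd zw) jB//.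
  rewrite -(jackson_dp_expansion_w (F := dp_sum2 q cB) q01 rw0 cB_normal _ zw)//.
  by have [_ ->] := two_face_jackson zw; rewrite linearB subrr.
(* Each use of the recursion lowers [r + s] by one and exchanges [e] and [f], until a face where the
   coefficient is zero. *)
have ef0 k : forall r s, (r + s <= k)%N -> e r s = 0 /\ f r s = 0.
  elim: k => [|k IH] r s rsk.
    move: rsk; rewrite leqn0 addn_eq0 => /andP[/eqP -> /eqP ->].
    by rewrite e0 f0.
  split.
    case: r rsk => [|r] rsk; first exact: e0.
    by have [|_ fz] := IH r s; [exact: rsk|rewrite eS fz linear0].
  case: s rsk => [|s] rsk; first exact: f0.
  by have [|ez _] := IH r s; [rewrite addnS in rsk|rewrite fS ez linear0].
move=> z w zw; split; apply: subr0_eq.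
  rewrite -eE//; rewrite (_ : e = fun _ _ => 0) ?dp_sum2_0//.
  by apply/funext => r; apply/funext => s; have [] := ef0 _ r s (leqnn _).
rewrite -fE//; rewrite (_ : f = fun _ _ => 0) ?dp_sum2_0//.
by apply/funext => r; apply/funext => s; have [] := ef0 _ r s (leqnn _).
Qed.

End TwoFaceProblem.

(** * Norms of the face data *)

Section DividedPowerNorm.
Context {R : realType} {X : completeNormedModType R[i]}.
Variables (q : R) (q01 : 0 < q < 1).
Implicit Types (rho : R) (u : nat -> X).

Lemma dp_norm_term_ge0 rho u k : 0 <= rho ->
  0 <= rho ^+ k / qfact q k * rnorm (u k).
Proof.
move=> rho0; rewrite mulr_ge0 ?rnorm_ge0// divr_ge0 ?exprn_ge0//.
exact/ltW/qfact_gt0.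
Qed.

Lemma dp_norm_leP rho u (M : R) : 0 <= rho ->
  (dp_norm q rho u <= M%:E)%E <->
  forall n, \sum_(k < n) rho ^+ k / qfact q k * rnorm (u k) <= M.
Proof.
by move=> rho0; apply: nneseries_leP => k; exact: dp_norm_term_ge0.
Qed.

Lemma dp_norm_mono rho rho' u : 0 <= rho <= rho' ->
  (dp_norm q rho u <= dp_norm q rho' u)%E.
Proof.
move=> /andP[rho0 le]; have rho0' := le_trans rho0 le.
apply: lee_nneseries => [k _ _|k _]; rewrite lee_fin.
  exact: dp_norm_term_ge0.
rewrite ler_wpM2r ?rnorm_ge0// ler_pM2r ?invr_gt0 ?qfact_gt0//.
by rewrite lerXn2r.
Qed.

Lemma dp_norm_fine rho u : 0 <= rho -> (dp_norm q rho u < +oo)%E ->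
  dp_norm q rho u = (fine (dp_norm q rho u))%:E.
Proof.
by move=> rho0; apply: fine_nneseries => k; exact: dp_norm_term_ge0.
Qed.

End DividedPowerNorm.

Theorem theorem4p4 (R : realType) (m : nat) (q Rz Rw : R)
    (X : completeNormedModType R[i]) (j : {linear poly_form R m.-1 -> X})
    (a b : nat -> X) (rho_z rho_w : R) :
  (2 <= m)%N -> 0 < q < 1 -> 0 < Rz -> 0 < Rw ->
  is_completion q j ->
  boundary_data q j a b Rz Rw ->
  0 < rho_z < Rz -> 0 < rho_w < Rw ->
  mu_q q j * rho_z * rho_w < (1 - q) ^- 2 ->
  let A := extA q j a b in
  let B := extB q j a b in
  [/\ dp_expansion q rho_z rho_w (extcoefA q j a b) A
        /\ dp_expansion q rho_z rho_w (extcoefB q j a b) B,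
      joint_monogenic q j rho_z rho_w A B
        /\ two_face_data q rho_z rho_w a b A B,
      forall A' B' : R[i] -> R[i] -> X,
        dp_class q rho_z rho_w A' -> dp_class q rho_z rho_w B' ->
        joint_monogenic q j rho_z rho_w A' B' ->
        two_face_data q rho_z rho_w a b A' B' ->
        forall z w, bidisc rho_z rho_w (z, w) ->
          A' z w = A z w /\ B' z w = B z w,
      forall z w, bidisc rho_z rho_w (z, w) ->
        ((rnorm (A z w))%:E <=
           Phi q (mu_q q j * rho_z * rho_w) *
           (dp_norm q rho_w a
              + (rho_z * opnorm (opD q j))%:E * dp_norm q rho_z b))%E
        /\
        ((rnorm (B z w))%:E <=
           Phi q (mu_q q j * rho_z * rho_w) *
           (dp_norm q rho_z b
              + (rho_w * opnorm (opDd q j))%:E * dp_norm q rho_w a))%E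
    & forall eps : R, 0 < eps -> exists2 delta : R, 0 < delta &
        forall a' b' : nat -> X, boundary_data q j a' b' Rz Rw ->
          (dp_norm q rho_w (fun s => (a' s - a s)%R) < delta%:E)%E ->
          (dp_norm q rho_z (fun r => (b' r - b r)%R) < delta%:E)%E ->
          forall z w, bidisc rho_z rho_w (z, w) ->
            rnorm (extA q j a' b' z w - A z w) < eps /\
            rnorm (extB q j a' b' z w - B z w) < eps].
Proof.
move=> _ q01 _ _ jX data /andP[rz0 rzR] /andP[rw0 rwR] mu_lt A B.
have [z0 w0] := (ltW rz0, ltW rw0).
have [S [MS [ES SM S2]]] := opDP q01 jX.
have [T [MT [ET TM T2]]] := opDdP q01 jX.
have Ulin : linear (fun x => - T x).
  by move=> c x y; rewrite linearP opprD scalerN.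
pose U : {linear X -> X} :=
  HB.pack (fun x => - T x) (GRing.isLinear.Build _ _ _ _ (fun x => - T x) Ulin).
have UE x : U x = - T x by [].
have UM x : rnorm (U x) <= MT * rnorm x by rewrite UE rnormN.
have U2 x : U (U x) = 0 by rewrite !UE linearN T2 !oppr0.
pose LS := opnorm S; pose LT := opnorm T.
have SL x : rnorm (S x) <= LS * rnorm x by exact: ler_opnorm SM.
have TL x : rnorm (T x) <= LT * rnorm x by exact: ler_opnorm TM.
have UL x : rnorm (U x) <= LT * rnorm x by rewrite UE rnormN.
have LS0 : 0 <= LS := opnorm_ge0 (linear0 S) SM.
have LT0 : 0 <= LT := opnorm_ge0 (linear0 T) TM.
pose mu := mu_q q j.
have muE : mu = Num.max (opnorm (S \o T)) (opnorm (T \o S)).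
  by rewrite /mu /mu_q ES ET.
have STM x : rnorm ((S \o T) x) <= LS * LT * rnorm x.
  by rewrite -mulrA (le_trans (SL _))// ler_wpM2l.
have TSM x : rnorm ((T \o S) x) <= LT * LS * rnorm x.
  by rewrite -mulrA (le_trans (TL _))// ler_wpM2l.
(* The sign in [U] disappears under the norm. Diagonals of A involve [S \o T], those of B involve
   [T \o S], hence the maximum in [mu]. *)
have SUmu x : rnorm (S (U x)) <= mu * rnorm x.
  rewrite UE linearN rnormN muE (le_trans (ler_opnorm (T := S \o T) x STM))//.
  by rewrite ler_wpM2r ?rnorm_ge0// le_max lexx.
have USmu x : rnorm (U (S x)) <= mu * rnorm x.
  rewrite UE rnormN muE (le_trans (ler_opnorm (T := T \o S) x TSM))//.
  by rewrite ler_wpM2r ?rnorm_ge0// le_max lexx orbT.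
have mu0 : 0 <= mu.
  rewrite muE le_max; apply/orP; left.
  by apply: (opnorm_ge0 _ STM); rewrite /= !linear0.
have t0 : 0 <= mu * rho_z * rho_w by rewrite !mulr_ge0.
have phi0 k : 0 <= (mu * rho_z * rho_w) ^+ k / qfact q k ^+ 2.
  by rewrite divr_ge0 ?exprn_ge0// ltW ?qfact_gt0.
have Phi_fin : (Phi q (mu * rho_z * rho_w) < +oo)%E.
  by apply: Phi_lty => //; rewrite t0.
pose P := fine (Phi q (mu * rho_z * rho_w)).
have PE : Phi q (mu * rho_z * rho_w) = P%:E by exact: fine_nneseries.
have PM n : \sum_(k < n) (mu * rho_z * rho_w) ^+ k / qfact q k ^+ 2 <= P.
  by apply: (nneseries_leP P phi0).1 n; rewrite -PE; exact: lexx.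
have P0 : 0 <= P by have := PM 0%N; rewrite big_ord0.
have coef a' b' : two_face_coef S U a' b' (extcoefA q j a' b') (extcoefB q j a' b').
  split=> [//|r|r s|r s]; first exact: extcoefB0.
    by rewrite extcoefAS ES.
  by rewrite extcoefBS ET.
have normE a' b' : boundary_data q j a' b' Rz Rw ->
    dp_norm q rho_w a' = (fine (dp_norm q rho_w a'))%:E
    /\ dp_norm q rho_z b' = (fine (dp_norm q rho_z b'))%:E.
  move=> [aA _ bA _]; split; apply: dp_norm_fine => //.
    by apply: le_lt_trans aA; rewrite dp_norm_mono// w0 ltW.
  by apply: le_lt_trans bA; rewrite dp_norm_mono// z0 ltW.
have normM a' b' : boundary_data q j a' b' Rz Rw ->
    (forall n, \sum_(s < n) rho_w ^+ s / qfact q s * rnorm (a' s)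
       <= fine (dp_norm q rho_w a'))
    /\ (forall n, \sum_(r < n) rho_z ^+ r / qfact q r * rnorm (b' r)
       <= fine (dp_norm q rho_z b')).
  move=> /normE[aE bE]; split.
    by apply/dp_norm_leP => //; rewrite -aE.
  by apply/dp_norm_leP => //; rewrite -bE.
have normal a' b' : boundary_data q j a' b' Rz Rw ->
    normal_cvg q rho_z rho_w (extcoefA q j a' b')
    /\ normal_cvg q rho_z rho_w (extcoefB q j a' b').
  move=> /normM[aM bM].
  exact: (two_face_normal_cvg q01 rz0 rw0 mu0 LS0 LT0 SL UL SUmu USmu PM aM bM).
have [An Bn] := normal _ _ data.
have [_ Da _ Db] := data.
have Sa s : S (a s) = 0 by rewrite -ES Da.
have Ub r : U (b r) = 0 by rewrite UE -ET Db oppr0.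
have jack := two_face_jackson q01 SM UM rz0 rw0 (coef a b) An Bn.
have null := two_face_null q01 SM UM S2 U2 (coef a b) An Bn Sa Ub.
split.
- by split; exact: dp_expansion_sum2.
- split; last exact: (two_face_data_sum2 q01 rz0 rw0 (coef a b)).
  split=> z w zw; rewrite ?ES ?ET.
    by have [? _] := null _ _ zw; have [? _] := jack _ _ zw.
  have [_ nB] := null _ _ zw; have [_ jB] := jack _ _ zw.
  (* The abstract problem gives the kernel equation for [- T]; the sign is removed here. *)
  by split=> //; apply: oppr_inj; rewrite oppr0.
- move=> A' B' cA' cB' [DA' DB'] data'.
  apply: (two_face_unique q01 SM UM rz0 rw0 (coef a b) An Bn) => // z w zw.
    by have [_] := DA' z w zw; rewrite ES.
  by have [_] := DB' z w zw; rewrite ET.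
- move=> z w zw; have [aM bM] := normM _ _ data; have [-> ->] := normE _ _ data.
  have [] := two_face_estimate q01 rz0 rw0 mu0 LS0 LT0 SL UL SUmu USmu PM aM bM
    (coef a b) zw.
  by rewrite PE ES ET -!EFinM !lee_fin.
(* [K] dominates the constants of both estimates when each data norm is at most [delta]. *)
move=> eps eps0; pose K := P * (1 + rho_z * LS + rho_w * LT).
have [zL wL] : 0 <= rho_z * LS /\ 0 <= rho_w * LT by rewrite !mulr_ge0.
have K0 : 0 <= K by rewrite mulr_ge0 ?addr_ge0.
have K1 : 0 < K + 1 by rewrite ltr_wpDl.
pose delta := eps / (K + 1).
have d0 : 0 < delta by rewrite divr_gt0.
have Kd : K * delta < eps.
  by rewrite /delta mulrA ltr_pdivrMr// mulrC ltr_pM2l// ltrDl.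
exists delta => // a' b' data' /ltW/(dp_norm_leP q01 _ _ w0) aM
  /ltW/(dp_norm_leP q01 _ _ z0) bM z w zw.
have [An' Bn'] := normal _ _ data'.
rewrite /A /B /extA /extB -(dp_sum2B q01 An' An zw) -(dp_sum2B q01 Bn' Bn zw).
(* The estimate is applied to the difference of the two coefficient families, with [delta] as bound
   for both of its data. *)
have [eA eB] := two_face_estimate q01 rz0 rw0 mu0 LS0 LT0 SL UL SUmu USmu PM aM bM
  (two_face_coefB (coef a b) (coef a' b')) zw.
split; [apply: (le_lt_trans eA)|apply: (le_lt_trans eB)]; apply: le_lt_trans Kd.
  rewrite /K -[leRHS]mulrA ler_wpM2l// !mulrDl mul1r -addrA lerD2l lerDl.
  by rewrite mulr_ge0// ltW.
rewrite /K -[leRHS]mulrA ler_wpM2l// !mulrDl mul1r addrAC lerDl.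
by rewrite mulr_ge0// ltW.
Qed.
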